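(* Let $(\mathcal C,\otimes)$ be a $K$-linear Gray semigroup. Then the $K$-modules $X^{\bullet,\bullet}(\mathcal C)$ together with the maps $\delta_h:X^{\bullet,\bullet}(\mathcal C)\to X^{\bullet+1,\bullet}(\mathcal C)$ and $\delta_v:X^{\bullet,\bullet}(\mathcal C)\to X^{\bullet,\bullet+1}(\mathcal C)$ define a double complex; that is, $\delta_h\circ\delta_h=0$, $\delta_v\circ\delta_v=0$ and $\delta_h\circ\delta_v=\delta_v\circ\delta_h$.
   Context: Conventions. $K$ is a commutative ring with unit. In a (strict) 2-category, $id_X$ is the identity 1-morphism, $1_f$ the identity 2-morphism, $\sigma\cdot\tau$ the vertical composite (first $\tau$), and $\circ$ denotes composition of 1-morphisms ($g\circ f$: first $f$) and horizontal composition of 2-morphisms. A 2-category is $K$-linear if its sets of 2-morphisms are $K$-modules and vertical and horizontal composition are $K$-bilinear. Gray semigroup. A Gray semigroup $(\mathcal C,\otimes)$ is a 2-category $\mathcal C$ with objects $X\otimes Y$, functors $\mathcal C(X,X')\times\mathcal C(Y,Y')\to\mathcal C(X\otimes Y,X'\otimes Y')$ written $(f,g)\mapsto f\otimes g$, $(\tau,\sigma)\mapsto\tau\otimes\sigma$, and 2-isomorphisms $\widehat\otimes((f',g'),(f,g)):(f'\otimes g')\circ(f\otimes g)\Rightarrow(f'\circ f)\otimes(g'\circ g)$, natural in all arguments, such that: $id_X\otimes id_Y=id_{X\otimes Y}$; $\widehat\otimes((f'',g''),(f'\circ f,g'\circ g))\cdot(1_{f''\otimes g''}\circ\widehat\otimes((f',g'),(f,g)))=\widehat\otimes((f''\circ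 f',g''\circ g'),(f,g))\cdot(\widehat\otimes((f'',g''),(f',g'))\circ1_{f\otimes g})$; $\widehat\otimes((id,id),(f,g))$ and $\widehat\otimes((f,g),(id,id))$ are identities; (cubical) all $\widehat\otimes((f',id),(f,g))$ and $\widehat\otimes((f,g'),(id,g))$ are identities; $\otimes$ is strictly associative on objects, 1-morphisms and 2-morphisms; and $(\widehat\otimes((f',g'),(f,g))\otimes1_{h'\circ h})\cdot\widehat\otimes((f'\otimes g',h'),(f\otimes g,h))=(1_{f'\circ f}\otimes\widehat\otimes((g',h'),(g,h)))\cdot\widehat\otimes((f',g'\otimes h'),(f,g\otimes h))$. It is $K$-linear if $\mathcal C$ is $K$-linear and $(\tau,\sigma)\mapsto\tau\otimes\sigma$ is $K$-bilinear. Modules and maps. For $m,n\ge1$ let $X^{m-1,n-1}(\mathcal C)$ be the $K$-module of families $\phi$ of 2-morphisms $\phi(f_0,\dots,f_{m-1}):T_0\circ\cdots\circ T_{m-1}\Rightarrow c^1\otimes\cdots\otimes c^n$, one for each sequence of composable $n$-tuples $f_j=(f_j^1,\dots,f_j^n)$ of 1-morphisms ($f_{m-1}$ applied first), where $T_j=f_j^1\otimes\cdots\otimes f_j^n$ and $c^k=f_0^k\circ\cdots\circ f_{m-1}^k$, natural with respect to 2-morphisms in all $f_j^k$. Composites $f_{j-1}\circ f_j$ are componentwise. For pairs $p_j=(f_j,g_j)$ put $\Theta_2(p_0)=1$, $\Theta_2(p_0,\dots,p_{m-1})=\widehat\otimes(p_0,p_1\circ\cdots\circ p_{m-1})\cdot(1_{f_0\otimes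 g_0}\circ\Theta_2(p_1,\dots,p_{m-1}))$. Put $\Theta_1=1$ and $\Theta_n((f_j^1,\dots,f_j^n)_j)=(1_{c^1}\otimes\Theta_{n-1}((f_j^2,\dots,f_j^n)_j))\cdot\Theta_2((f_j^1,f_j^2\otimes\cdots\otimes f_j^n)_j)$ for $n\geq 3$. Define $\delta_h:X^{m-1,n-1}(\mathcal C)\to X^{m,n-1}(\mathcal C)$ by $$(\delta_h\phi)(f_0,\dots,f_m)=\Theta_n(f_0,f_1\circ\cdots\circ f_m)\cdot(1_{T_0}\circ\phi(f_1,\dots,f_m))+\sum_{i=1}^m(-1)^i\phi(\dots,f_{i-1}\circ f_i,\dots)\cdot(1\circ\Theta_n(f_{i-1},f_i)\circ1)+(-1)^{m+1}\Theta_n(f_0\circ\cdots\circ f_{m-1},f_m)\cdot(\phi(f_0,\dots,f_{m-1})\circ1_{T_m}),$$ where the outer $1$'s are identities of the remaining $T_j$'s. Define $\delta_v:X^{m-1,n-1}(\mathcal C)\to X^{m-1,n}(\mathcal C)$, for $f_j=(f_j^0,\dots,f_j^n)$, by $$(\delta_v\phi)(f_0,\dots,f_{m-1})=(1_{c^0}\otimes\phi((f_j^1,\dots,f_j^n)_j))\cdot\Theta_2((f_j^0,f_j^1\otimes\cdots\otimes f_j^n)_j)+\sum_{i=1}^n(-1)^i(1\otimes\Theta_2((f_j^{i-1},f_j^i)_j)\otimes1)\cdot\phi((f_j^0,\dots,f_j^{i-1}\otimes f_j^i,\dots,f_j^n)_j)+(-1)^{n+1}(\phi((f_j^0,\dots,f_j^{n-1})_j)\otimes1_{c^n})\cdot\Theta_2((f_j^0\otimes\cdots\otimes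 f_j^{n-1},f_j^n)_j),$$ where the outer $1$'s are identities of the remaining $c^k$'s. *)

(* Defs.v *)
From HB Require Import structures.
From mathcomp Require Import all_boot all_algebra.
From mathcomp Require Import boolp.

Set Implicit Arguments.
Unset Strict Implicit.
Unset Printing Implicit Defensive.

Import GRing.Theory.
Local Open Scope ring_scope.

Declare Scope cell_scope.
Delimit Scope cell_scope with cell.
Local Open Scope cell_scope.

(* The index set {0, ..., n-1}, as an iterated option type rather than 'I_n:
   with [Some] for i |-> i + 1 and [fwiden] for the inclusion, the identity
   [fwiden (Some i) = Some (fwiden i)] holds by computation. This is what lets
   chains of composable arrows be indexed families without transports. *)
Fixpoint fin (n : nat) : finType :=
  if n is p.+1 then (option (fin p) : finType) else (void : finType).

Fixpoint fval n : fin n -> nat :=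
  match n with
  | 0 => fun i => match i with end
  | p.+1 => fun i => if i is Some j then (fval j).+1 else 0%N
  end.

Fixpoint fwiden n : fin n -> fin n.+1 :=
  match n with
  | 0 => fun i => match i with end
  | p.+1 => fun i => if i is Some j then Some (fwiden j) else None
  end.

Fixpoint fmax n : fin n.+1 := if n is p.+1 then Some (fmax p) else None.

(* [face i] is the increasing map that misses the value i + 1. *)
Fixpoint face n : fin n -> fin n.+1 -> fin n.+2 :=
  match n with
  | 0 => fun i => match i with end
  | p.+1 => fun i j =>
      match j with
      | None => None
      | Some j' => match i with
                   | None => Some (Some j')
                   | Some i' => Some (face i' j')
                   end
      end
  end.

Record two_graph (K : pzRingType) := TwoGraph {
  obj : Type;
  hom : obj -> obj -> Type;
  hom2 : forall X Y : obj, hom X Y -> hom X Y -> lmodType K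
}.
Arguments hom {K t} _ _.
Arguments hom2 {K t X Y} _ _.

Section Boundaries.
Variables (K : pzRingType) (C : two_graph K).

Record arr := MkArr { asrc : obj C; atgt : obj C; aval : hom asrc atgt }.

Record par := MkPar {
  psrc : obj C; ptgt : obj C; pdom : hom psrc ptgt; pcod : hom psrc ptgt
}.

Definition hom2p (p : par) : lmodType K := hom2 (pdom p) (pcod p).

End Boundaries.

Definition Arr K (C : two_graph K) (X Y : obj C) (f : hom X Y) : arr C :=
  MkArr f.
Definition Par K (C : two_graph K) (X Y : obj C) (f g : hom X Y) : par C :=
  MkPar f g.

(* A 2-morphism together with its boundary. An equation [Cell s = Cell t]
   states that s and t are the same 2-morphism when their boundaries are equal
   without being syntactically so, e.g. because composition is associative. *)
Definition Cell K (C : two_graph K) (X Y : obj C) (f g : hom X Y)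
    (s : hom2 f g) : {p : par C & hom2p p} :=
  existT (@hom2p K C) (Par f g) s.

(* Transport along an equality of boundaries; see [Cell_cast]. *)
Definition cast K (C : two_graph K) (X Y X' Y' : obj C) (f g : hom X Y)
    (f' g' : hom X' Y') (e : Par f g = Par f' g') (s : hom2 f g) : hom2 f' g' :=
  eq_rect (Par f g) (@hom2p K C) s (Par f' g') e.

Reserved Notation "g ∘ f" (at level 38, right associativity).
Reserved Notation "t ∘₂ s" (at level 38, right associativity).
Reserved Notation "t ⋅ s" (at level 45, right associativity).
Reserved Notation "f ⊗ g" (at level 36, right associativity).
Reserved Notation "X ⊗₀ Y" (at level 36, right associativity).
Reserved Notation "s ⊗₂ t" (at level 36, right associativity).

(* Strict 2-categories: [g ∘ f] and [t ∘₂ s] are the compositions of 1-morphisms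
   and the horizontal composition, [t ⋅ s] the vertical one, all with the right
   factor first. *)
Record linear_2category (K : pzRingType) := Linear2Category {
  cells :> two_graph K;
  id1 : forall X : obj cells, hom X X;
  comp : forall X Y Z : obj cells, hom Y Z -> hom X Y -> hom X Z
    where "g ∘ f" := (comp g f);
  id2 : forall (X Y : obj cells) (f : hom X Y), hom2 f f;
  vcomp : forall (X Y : obj cells) (f g h : hom X Y),
    hom2 g h -> hom2 f g -> hom2 f h
    where "t ⋅ s" := (vcomp t s);
  hcomp : forall (X Y Z : obj cells) (g g' : hom Y Z) (f f' : hom X Y),
    hom2 g g' -> hom2 f f' -> hom2 (g ∘ f) (g' ∘ f')
    where "t ∘₂ s" := (hcomp t s);
  vcompA : forall (X Y : obj cells) (f g h k : hom X Y)
    (r : hom2 h k) (t : hom2 g h) (s : hom2 f g), r ⋅ (t ⋅ s) = (r ⋅ t) ⋅ s;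
  vcomp1s : forall (X Y : obj cells) (f g : hom X Y) (s : hom2 f g),
    id2 g ⋅ s = s;
  vcomps1 : forall (X Y : obj cells) (f g : hom X Y) (s : hom2 f g),
    s ⋅ id2 f = s;
  hcomp11 : forall (X Y Z : obj cells) (g : hom Y Z) (f : hom X Y),
    id2 g ∘₂ id2 f = id2 (g ∘ f);
  hcompV : forall (X Y Z : obj cells) (g g' g'' : hom Y Z) (f f' f'' : hom X Y)
    (t' : hom2 g' g'') (t : hom2 g g') (s' : hom2 f' f'') (s : hom2 f f'),
    (t' ⋅ t) ∘₂ (s' ⋅ s) = (t' ∘₂ s') ⋅ (t ∘₂ s);
  compA : forall (W X Y Z : obj cells)
    (h : hom Y Z) (g : hom X Y) (f : hom W X), h ∘ (g ∘ f) = (h ∘ g) ∘ f;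
  comp1f : forall (X Y : obj cells) (f : hom X Y), id1 Y ∘ f = f;
  compf1 : forall (X Y : obj cells) (f : hom X Y), f ∘ id1 X = f;
  hcompA : forall (W X Y Z : obj cells)
    (h h' : hom Y Z) (g g' : hom X Y) (f f' : hom W X)
    (r : hom2 h h') (t : hom2 g g') (s : hom2 f f'),
    Cell (r ∘₂ (t ∘₂ s)) = Cell ((r ∘₂ t) ∘₂ s);
  hcomp1s : forall (X Y : obj cells) (f f' : hom X Y) (s : hom2 f f'),
    Cell (id2 (id1 Y) ∘₂ s) = Cell s;
  hcomps1 : forall (X Y : obj cells) (f f' : hom X Y) (s : hom2 f f'),
    Cell (s ∘₂ id2 (id1 X)) = Cell s;
  vcomp_linearl : forall (X Y : obj cells) (f g h : hom X Y) (s : hom2 f g),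
    linear (fun t : hom2 g h => t ⋅ s);
  vcomp_linearr : forall (X Y : obj cells) (f g h : hom X Y) (t : hom2 g h),
    linear (fun s : hom2 f g => t ⋅ s);
  hcomp_linearl : forall (X Y Z : obj cells) (g g' : hom Y Z) (f f' : hom X Y)
    (s : hom2 f f'), linear (fun t : hom2 g g' => t ∘₂ s);
  hcomp_linearr : forall (X Y Z : obj cells) (g g' : hom Y Z) (f f' : hom X Y)
    (t : hom2 g g'), linear (fun s : hom2 f f' => t ∘₂ s)
}.

Notation "g ∘ f" := (comp g f) : cell_scope.
Notation "t ⋅ s" := (vcomp t s) : cell_scope.
Notation "t ∘₂ s" := (hcomp t s) : cell_scope.
Arguments id1 {K l} X.
Arguments id2 {K l X Y} f.

Definition is_identity K (C : linear_2category K) (X Y : obj C) (f g : hom X Y)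
    (s : hom2 f g) : Prop := Cell s = Cell (id2 f).

Definition is_iso K (C : linear_2category K) (X Y : obj C) (f g : hom X Y)
    (s : hom2 f g) : Prop :=
  exists t : hom2 g f, t ⋅ s = id2 f /\ s ⋅ t = id2 g.

(* [that f' g' f g] is the 2-isomorphism hat-otimes((f', g'), (f, g)). *)
Record linear_gray_semigroup (K : pzRingType) := LinearGraySemigroup {
  cat2 :> linear_2category K;
  tobj : obj cat2 -> obj cat2 -> obj cat2
    where "X ⊗₀ Y" := (tobj X Y);
  tens : forall X X' Y Y' : obj cat2,
    hom X X' -> hom Y Y' -> hom (X ⊗₀ Y) (X' ⊗₀ Y')
    where "f ⊗ g" := (tens f g);
  tens2 : forall (X X' Y Y' : obj cat2) (f f' : hom X X') (g g' : hom Y Y'),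
    hom2 f f' -> hom2 g g' -> hom2 (f ⊗ g) (f' ⊗ g')
    where "s ⊗₂ t" := (tens2 s t);
  that : forall (X X' X'' Y Y' Y'' : obj cat2)
    (f' : hom X' X'') (g' : hom Y' Y'') (f : hom X X') (g : hom Y Y'),
    hom2 ((f' ⊗ g') ∘ (f ⊗ g)) ((f' ∘ f) ⊗ (g' ∘ g));
  tens2_11 : forall (X X' Y Y' : obj cat2) (f : hom X X') (g : hom Y Y'),
    id2 f ⊗₂ id2 g = id2 (f ⊗ g);
  tens2V : forall (X X' Y Y' : obj cat2)
    (f f' f'' : hom X X') (g g' g'' : hom Y Y')
    (s' : hom2 f' f'') (s : hom2 f f') (t' : hom2 g' g'') (t : hom2 g g'),
    (s' ⋅ s) ⊗₂ (t' ⋅ t) = (s' ⊗₂ t') ⋅ (s ⊗₂ t);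
  that_iso : forall (X X' X'' Y Y' Y'' : obj cat2)
    (f' : hom X' X'') (g' : hom Y' Y'') (f : hom X X') (g : hom Y Y'),
    is_iso (that f' g' f g);
  that_natural : forall (X X' X'' Y Y' Y'' : obj cat2)
    (f1' f2' : hom X' X'') (g1' g2' : hom Y' Y'')
    (f1 f2 : hom X X') (g1 g2 : hom Y Y')
    (s' : hom2 f1' f2') (t' : hom2 g1' g2') (s : hom2 f1 f2) (t : hom2 g1 g2),
    that f2' g2' f2 g2 ⋅ ((s' ⊗₂ t') ∘₂ (s ⊗₂ t)) =
    ((s' ∘₂ s) ⊗₂ (t' ∘₂ t)) ⋅ that f1' g1' f1 g1;
  tens_id1 : forall X Y : obj cat2, id1 X ⊗ id1 Y = id1 (X ⊗₀ Y);
  that_assoc : forall (X X' X'' X''' Y Y' Y'' Y''' : obj cat2)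
    (f'' : hom X'' X''') (g'' : hom Y'' Y''')
    (f' : hom X' X'') (g' : hom Y' Y'') (f : hom X X') (g : hom Y Y'),
    Cell (that f'' g'' (f' ∘ f) (g' ∘ g)
            ⋅ (id2 (f'' ⊗ g'') ∘₂ that f' g' f g)) =
    Cell (that (f'' ∘ f') (g'' ∘ g') f g
            ⋅ (that f'' g'' f' g' ∘₂ id2 (f ⊗ g)));
  that_idl : forall (X X' Y Y' : obj cat2) (f : hom X X') (g : hom Y Y'),
    is_identity (that (id1 X') (id1 Y') f g);
  that_idr : forall (X X' Y Y' : obj cat2) (f : hom X X') (g : hom Y Y'),
    is_identity (that f g (id1 X) (id1 Y));
  that_cubicall : forall (X X' X'' Y Y' : obj cat2)
    (f' : hom X' X'') (f : hom X X') (g : hom Y Y'),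
    is_identity (that f' (id1 Y') f g);
  that_cubicalr : forall (X X' Y Y' Y'' : obj cat2)
    (f : hom X X') (g' : hom Y' Y'') (g : hom Y Y'),
    is_identity (that f g' (id1 X) g);
  tobjA : forall X Y Z : obj cat2, X ⊗₀ (Y ⊗₀ Z) = (X ⊗₀ Y) ⊗₀ Z;
  tensA : forall (X X' Y Y' Z Z' : obj cat2)
    (f : hom X X') (g : hom Y Y') (h : hom Z Z'),
    Arr (f ⊗ (g ⊗ h)) = Arr ((f ⊗ g) ⊗ h);
  tens2A : forall (X X' Y Y' Z Z' : obj cat2)
    (f f' : hom X X') (g g' : hom Y Y') (h h' : hom Z Z')
    (s : hom2 f f') (t : hom2 g g') (r : hom2 h h'),
    Cell (s ⊗₂ (t ⊗₂ r)) = Cell ((s ⊗₂ t) ⊗₂ r);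
  that_tens : forall (X X' X'' Y Y' Y'' Z Z' Z'' : obj cat2)
    (f' : hom X' X'') (g' : hom Y' Y'') (h' : hom Z' Z'')
    (f : hom X X') (g : hom Y Y') (h : hom Z Z'),
    Cell ((that f' g' f g ⊗₂ id2 (h' ∘ h)) ⋅ that (f' ⊗ g') h' (f ⊗ g) h) =
    Cell ((id2 (f' ∘ f) ⊗₂ that g' h' g h) ⋅ that f' (g' ⊗ h') f (g ⊗ h));
  tens2_linearl : forall (X X' Y Y' : obj cat2)
    (f f' : hom X X') (g g' : hom Y Y') (t : hom2 g g'),
    linear (fun s : hom2 f f' => s ⊗₂ t);
  tens2_linearr : forall (X X' Y Y' : obj cat2)
    (f f' : hom X X') (g g' : hom Y Y') (s : hom2 f f'),
    linear (fun t : hom2 g g' => s ⊗₂ t)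
}.

Notation "X ⊗₀ Y" := (tobj X Y) : cell_scope.
Notation "f ⊗ g" := (tens f g) : cell_scope.
Notation "s ⊗₂ t" := (tens2 s t) : cell_scope.

Section Composites.
Variables (K : pzRingType) (C : linear_2category K).

(* A chain of m + 1 composable 1-morphisms; the last one is applied first. *)
Definition chain m (X : fin m.+2 -> obj C) : Type :=
  forall j : fin m.+1, hom (X (Some j)) (X (fwiden j)).

Fixpoint bigcomp m : forall X : fin m.+2 -> obj C,
    chain X -> hom (X (fmax m.+1)) (X None) :=
  match m with
  | 0 => fun X f => f None
  | p.+1 => fun X f =>
      f None ∘ @bigcomp p (fun j => X (Some j)) (fun j => f (Some j))
  end.

Fixpoint bigcomp2 m : forall (X : fin m.+2 -> obj C) (f g : chain X),
    (forall j, hom2 (f j) (g j)) -> hom2 (bigcomp f) (bigcomp g) :=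
  match m with
  | 0 => fun X f g s => s None
  | p.+1 => fun X f g s =>
      s None ∘₂ @bigcomp2 p (fun j => X (Some j)) (fun j => f (Some j))
                  (fun j => g (Some j)) (fun j => s (Some j))
  end.

(* [hmerge i f] is (f_0, ..., f_i o f_(i+1), ..., f_(m+1)). *)
Fixpoint hmerge m : forall (i : fin m.+1) (X : fin m.+3 -> obj C),
    chain X -> @chain m (fun j => X (face i j)) :=
  match m with
  | 0 => fun i =>
      match i with
      | None => fun X f j =>
          match j with
          | None => f None ∘ f (Some None)
          | Some v => match v with end
          end
      | Some v => match v with end
      end
  | p.+1 => fun i =>
      match i with
      | None => fun X f j =>
          match j with
          | None => f None ∘ f (Some None)
          | Some j' => f (Some (Some j'))
          end
      | Some i' => fun X f j =>
          match j with
          | None => f None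
          | Some j' =>
            @hmerge p i' (fun j => X (Some j)) (fun j => f (Some j)) j'
          end
      end
  end.

End Composites.

Section Tuples.
Variables (K : pzRingType) (C : linear_gray_semigroup K).

Fixpoint bigtens0 n : (fin n.+1 -> obj C) -> obj C :=
  match n with
  | 0 => fun X => X None
  | p.+1 => fun X => X None ⊗₀ @bigtens0 p (fun k => X (Some k))
  end.

Fixpoint bigtens n : forall X Y : fin n.+1 -> obj C,
    (forall k, hom (X k) (Y k)) -> hom (bigtens0 X) (bigtens0 Y) :=
  match n with
  | 0 => fun X Y f => f None
  | p.+1 => fun X Y f =>
      f None ⊗ @bigtens p (fun k => X (Some k)) (fun k => Y (Some k))
                 (fun k => f (Some k))
  end.

Fixpoint bigtens2 n : forall (X Y : fin n.+1 -> obj C)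
    (f g : forall k, hom (X k) (Y k)),
    (forall k, hom2 (f k) (g k)) -> hom2 (bigtens f) (bigtens g) :=
  match n with
  | 0 => fun X Y f g s => s None
  | p.+1 => fun X Y f g s =>
      s None ⊗₂ @bigtens2 p (fun k => X (Some k)) (fun k => Y (Some k))
                  (fun k => f (Some k)) (fun k => g (Some k))
                  (fun k => s (Some k))
  end.

(* [vmerge0 i], [vmerge i] tensor together the entries i and i + 1. *)
Fixpoint vmerge0 n : fin n.+1 -> (fin n.+2 -> obj C) -> fin n.+1 -> obj C :=
  match n with
  | 0 => fun i X k => X None ⊗₀ X (Some None)
  | p.+1 => fun i X k =>
      match i, k with
      | None, None => X None ⊗₀ X (Some None)
      | None, Some k' => X (Some (Some k'))
      | Some i', None => X None
      | Some i', Some k' => @vmerge0 p i' (fun k => X (Some k)) k'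
      end
  end.

Fixpoint vmerge n : forall (i : fin n.+1) (X Y : fin n.+2 -> obj C),
    (forall k, hom (X k) (Y k)) ->
    forall k, hom (vmerge0 i X k) (vmerge0 i Y k) :=
  match n with
  | 0 => fun i X Y f k => f None ⊗ f (Some None)
  | p.+1 => fun i X Y f k =>
      match i, k with
      | None, None => f None ⊗ f (Some None)
      | None, Some k' => f (Some (Some k'))
      | Some i', None => f None
      | Some i', Some k' =>
          @vmerge p i' (fun k => X (Some k)) (fun k => Y (Some k))
            (fun k => f (Some k)) k'
      end
  end.

(* m + 1 composable (n + 1)-tuples of 1-morphisms; [f j k] is f_j^k, the row
   with the largest j being applied first. *)
Definition grid m n (X : fin m.+2 -> fin n.+1 -> obj C) : Type :=
  forall (j : fin m.+1) (k : fin n.+1), hom (X (Some j) k) (X (fwiden j) k).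

Definition row_tens m n (X : fin m.+2 -> fin n.+1 -> obj C) (f : grid X) :
    @chain K C m (fun j => bigtens0 (X j)) := fun j => bigtens (f j).

Definition col m n (X : fin m.+2 -> fin n.+1 -> obj C) (f : grid X)
    (k : fin n.+1) : @chain K C m (fun j => X j k) := fun j => f j k.

Definition col_comp m n (X : fin m.+2 -> fin n.+1 -> obj C) (f : grid X)
    (k : fin n.+1) : hom (X (fmax m.+1) k) (X None k) := bigcomp (col f k).

Definition gdom m n (X : fin m.+2 -> fin n.+1 -> obj C) (f : grid X) :=
  bigcomp (row_tens f).

Definition gcod m n (X : fin m.+2 -> fin n.+1 -> obj C) (f : grid X) :=
  bigtens (col_comp f).

Definition row_tens2 m n (X : fin m.+2 -> fin n.+1 -> obj C) (f g : grid X)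
    (s : forall j k, hom2 (f j k) (g j k)) : hom2 (gdom f) (gdom g) :=
  bigcomp2 (f := row_tens f) (g := row_tens g) (fun j => bigtens2 (s j)).

Definition col_comp2 m n (X : fin m.+2 -> fin n.+1 -> obj C) (f g : grid X)
    (s : forall j k, hom2 (f j k) (g j k)) : hom2 (gcod f) (gcod g) :=
  bigtens2 (f := col_comp f) (g := col_comp g)
    (fun k => bigcomp2 (f := col f k) (g := col g k) (fun j => s j k)).

Definition chain_tens m (X Y : fin m.+2 -> obj C) (f : chain X) (g : chain Y) :
    @chain K C m (fun j => X j ⊗₀ Y j) := fun j => f j ⊗ g j.

Fixpoint Theta2 m : forall (X Y : fin m.+2 -> obj C)
    (f : chain X) (g : chain Y),
    hom2 (bigcomp (chain_tens f g)) (bigcomp f ⊗ bigcomp g) :=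
  match m with
  | 0 => fun X Y f g => id2 (f None ⊗ g None)
  | p.+1 => fun X Y f g =>
      that (f None) (g None)
        (@bigcomp K C p (fun j => X (Some j)) (fun j => f (Some j)))
        (@bigcomp K C p (fun j => Y (Some j)) (fun j => g (Some j)))
      ⋅ (id2 (f None ⊗ g None)
           ∘₂ @Theta2 p (fun j => X (Some j)) (fun j => Y (Some j))
                (fun j => f (Some j)) (fun j => g (Some j)))
  end.

Definition del_first_col m n (X : fin m.+2 -> fin n.+2 -> obj C) (f : grid X) :
    @grid m n (fun j k => X j (Some k)) := fun j k => f j (Some k).

Definition del_last_col m n (X : fin m.+2 -> fin n.+2 -> obj C) (f : grid X) :
    @grid m n (fun j k => X j (fwiden k)) := fun j k => f j (fwiden k).

Definition del_first_row m n (X : fin m.+3 -> fin n.+1 -> obj C) (f : grid X) :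
    @grid m n (fun j k => X (Some j) k) := fun j k => f (Some j) k.

Definition del_last_row m n (X : fin m.+3 -> fin n.+1 -> obj C) (f : grid X) :
    @grid m n (fun j k => X (fwiden j) k) := fun j k => f (fwiden j) k.

(* As [grid m n] has n + 1 columns, [Theta] at n is Theta_(n+1). For n = 1 the
   second clause reads (1 ⊗₂ 1) ⋅ Theta_2, that is Theta_2: see [Theta_2E]. *)
Fixpoint Theta m n : forall (X : fin m.+2 -> fin n.+1 -> obj C) (f : grid X),
    hom2 (gdom f) (gcod f) :=
  match n with
  | 0 => fun X f => id2 (gdom f)
  | p.+1 => fun X f =>
      (id2 (col_comp f None) ⊗₂ Theta (del_first_col f))
      ⋅ Theta2 (col f None) (row_tens (del_first_col f))
  end.

Definition grid2 n (X Y Z : fin n.+1 -> obj C)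
    (g : forall k, hom (Y k) (Z k)) (f : forall k, hom (X k) (Y k)) :
    @grid 1 n (fun j k => match j with
                          | None => Z k | Some None => Y k
                          | Some (Some _) => X k
                          end) :=
  fun j k => match j with
             | None => g k
             | Some None => f k
             | Some (Some v) => match v with end
             end.

(* Theta of a pair of composable tuples, written Theta_n(g, f). *)
Definition Theta_pair n (X Y Z : fin n.+1 -> obj C)
    (g : forall k, hom (Y k) (Z k)) (f : forall k, hom (X k) (Y k)) :
    hom2 (bigtens g ∘ bigtens f) (bigtens (fun k => g k ∘ f k)) :=
  Theta (grid2 g f).

Definition grid_hmerge m n (i : fin m.+1) (X : fin m.+3 -> fin n.+1 -> obj C)
    (f : grid X) : @grid m n (fun j => X (face i j)) :=
  fun j k => hmerge i (col f k) j.

Definition grid_vmerge m n (i : fin n.+1) (X : fin m.+2 -> fin n.+2 -> obj C)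
    (f : grid X) : @grid m n (fun j => vmerge0 i (X j)) :=
  fun j => vmerge i (f j).

(* Theta_n(f_i, f_(i+1)) in position i and identities elsewhere. *)
Fixpoint hmerge_Theta m n : forall (i : fin m.+1)
    (X : fin m.+3 -> fin n.+1 -> obj C) (f : grid X) (j : fin m.+1),
    hom2 (hmerge i (row_tens f) j) (row_tens (grid_hmerge i f) j) :=
  match m with
  | 0 => fun i =>
      match i with
      | None => fun X f j =>
          match j with
          | None => Theta_pair (f None) (f (Some None))
          | Some v => match v with end
          end
      | Some v => match v with end
      end
  | p.+1 => fun i =>
      match i with
      | None => fun X f j =>
          match j with
          | None => Theta_pair (f None) (f (Some None))
          | Some j' => id2 (bigtens (f (Some (Some j'))))
          end
      | Some i' => fun X f j =>
          match j with
          | None => id2 (bigtens (f None))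
          | Some j' => @hmerge_Theta p n i' _ (del_first_row f) j'
          end
      end
  end.

(* Theta_2((f_j^i, f_j^(i+1))_j) in position i and identities elsewhere. *)
Fixpoint vmerge_Theta m n : forall (i : fin n.+1)
    (X : fin m.+2 -> fin n.+2 -> obj C) (f : grid X) (k : fin n.+1),
    hom2 (col_comp (grid_vmerge i f) k) (vmerge i (col_comp f) k) :=
  match n with
  | 0 => fun i X f k => Theta2 (col f None) (col f (Some None))
  | p.+1 => fun i =>
      match i with
      | None => fun X f k =>
          match k with
          | None => Theta2 (col f None) (col f (Some None))
          | Some k' => id2 (col_comp f (Some (Some k')))
          end
      | Some i' => fun X f k =>
          match k with
          | None => id2 (col_comp f None)
          | Some k' => @vmerge_Theta m p i' _ (del_first_col f) k'
          end
      end
  end.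

End Tuples.

Section CellTheory.
Variables (K : pzRingType) (C : two_graph K).

Lemma existT_injc T (P : T -> Type) (x : T) (a b : P x) :
  existT P x a = existT P x b -> a = b.
Proof. exact: (@existT_inj2 {classic T}). Qed.

Lemma Arr_inj (X Y : obj C) (f g : hom X Y) : Arr f = Arr g -> f = g.
Proof.
move=> E; apply: (@existT_injc _ (fun Y => hom X Y)).
apply: (@existT_injc _ (fun X => {Y : obj C & hom X Y})).
exact: (f_equal (fun a => existT (fun X => {Y : obj C & hom X Y}) (asrc a)
  (existT (fun Y => hom (asrc a) Y) (atgt a) (aval a))) E).
Qed.

Lemma Cell_inj (X Y : obj C) (f g : hom X Y) (s t : hom2 f g) :
  Cell s = Cell t -> s = t.
Proof. exact: existT_injc. Qed.

Lemma Cell_cast (X Y X' Y' : obj C) (f g : hom X Y) (f' g' : hom X' Y')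
  (e : Par f g = Par f' g') (s : hom2 f g) : Cell (cast e s) = Cell s.
Proof.
rewrite /cast; change (existT (@hom2p K C) (Par f' g')
  (eq_rect (Par f g) (@hom2p K C) s (Par f' g') e) = Cell s).
by case: _ / e.
Qed.

Lemma cast_linear (X Y X' Y' : obj C) (f g : hom X Y) (f' g' : hom X' Y')
  (e : Par f g = Par f' g') : linear (@cast K C X Y X' Y' f g f' g' e).
Proof.
move=> a s t; rewrite /cast; move: e.
change (hom2 f' g') with (hom2p (Par f' g')).
by move: (Par f' g') => p e; case: _ / e.
Qed.

Section CellEq.
Variables (X Y X' Y' : obj C) (f g : hom X Y) (f' g' : hom X' Y').
Variables (s : hom2 f g) (s' : hom2 f' g').
Hypothesis E : Cell s = Cell s'.

Lemma Cell_par : Par f g = Par f' g'. Proof. exact: existT_inj1 E. Qed.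
Lemma Cell_dom : Arr f = Arr f'.
Proof. exact (f_equal (fun p : par C => Arr (pdom p)) Cell_par). Qed.
Lemma Cell_cod : Arr g = Arr g'.
Proof. exact (f_equal (fun p : par C => Arr (pcod p)) Cell_par). Qed.
Lemma Cell_src : X = X'. Proof. exact (f_equal (@asrc K C) Cell_dom). Qed.
Lemma Cell_tgt : Y = Y'. Proof. exact (f_equal (@atgt K C) Cell_dom). Qed.
End CellEq.

Lemma Par_eq (X Y X' Y' : obj C) (f g : hom X Y) (f' g' : hom X' Y') :
  Arr f = Arr f' -> Arr g = Arr g' -> Par f g = Par f' g'.
Proof.
move=> Ef Eg; move: (f_equal (@asrc K C) Ef) (f_equal (@atgt K C) Ef) => /= eX eY.
by subst X' Y'; rewrite (Arr_inj Ef) (Arr_inj Eg).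
Qed.

End CellTheory.

Ltac cell_subst E :=
  let eX := fresh in let eY := fresh in let ef := fresh in let eg := fresh in
  have eX := Cell_src E; have eY := Cell_tgt E; subst;
  have ef := Arr_inj (Cell_dom E); have eg := Arr_inj (Cell_cod E); subst;
  move/Cell_inj: E => E; subst.

Section CompositeTheory.
Variables (K : pzRingType) (C : linear_2category K).

Lemma Cell_id2 (X Y X' Y' : obj C) (f : hom X Y) (f' : hom X' Y') :
  Arr f = Arr f' -> Cell (id2 f) = Cell (id2 f').
Proof.
move=> E; move: (f_equal (@asrc K C) E) (f_equal (@atgt K C) E) => /= eX eY.
by subst X' Y'; rewrite (Arr_inj E).
Qed.

Lemma eq_vcompl (X Y : obj C) (f g h : hom X Y) (t t' : hom2 g h)
  (s : hom2 f g) : t = t' -> t ⋅ s = t' ⋅ s.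
Proof. by move=> ->. Qed.

Lemma Cell_vcomp (X Y X' Y' : obj C) (f g h : hom X Y) (f' g' h' : hom X' Y')
    (t : hom2 g h) (s : hom2 f g) (t' : hom2 g' h') (s' : hom2 f' g') :
  Cell t = Cell t' -> Cell s = Cell s' -> Cell (t ⋅ s) = Cell (t' ⋅ s').
Proof.
move=> Et Es; cell_subst Et; have ef := Arr_inj (Cell_dom Es); subst.
by rewrite (Cell_inj Es).
Qed.

Lemma Cell_hcomp (X Y Z X' Y' Z' : obj C) (g1 g2 : hom Y Z) (f1 f2 : hom X Y)
    (g1' g2' : hom Y' Z') (f1' f2' : hom X' Y')
    (t : hom2 g1 g2) (s : hom2 f1 f2) (t' : hom2 g1' g2') (s' : hom2 f1' f2') :
  Cell t = Cell t' -> Cell s = Cell s' -> Cell (t ∘₂ s) = Cell (t' ∘₂ s').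
Proof. by move=> Et Es; cell_subst Et; cell_subst Es. Qed.

Lemma Cell_bigcomp2 m (X X' : fin m.+2 -> obj C) (f g : chain X)
    (f' g' : chain X') (s : forall j, hom2 (f j) (g j))
    (s' : forall j, hom2 (f' j) (g' j)) :
  (forall j, Cell (s j) = Cell (s' j)) -> Cell (bigcomp2 s) = Cell (bigcomp2 s').
Proof.
elim: m X X' f g f' g' s s' => [|m IHm] X X' f g f' g' s s' E /=; first exact: E.
by apply: Cell_hcomp; [exact: E | apply: IHm => j; exact: E].
Qed.

Lemma Arr_bigcomp m (X X' : fin m.+2 -> obj C) (f : chain X) (f' : chain X') :
  (forall j, Arr (f j) = Arr (f' j)) -> Arr (bigcomp f) = Arr (bigcomp f').
Proof.
move=> E; apply: (@Cell_dom _ _ _ _ _ _ _ _ _ _ (bigcomp2 (fun j => id2 (f j)))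
  (bigcomp2 (fun j => id2 (f' j)))).
by apply: Cell_bigcomp2 => j; exact: Cell_id2.
Qed.

Lemma bigcomp2V m (X : fin m.+2 -> obj C) (f g h : chain X)
    (t : forall j, hom2 (g j) (h j)) (s : forall j, hom2 (f j) (g j)) :
  bigcomp2 (fun j => t j ⋅ s j) = bigcomp2 t ⋅ bigcomp2 s.
Proof.
by elim: m X f g h t s => [|m IHm] X f g h t s //=; rewrite -hcompV -IHm.
Qed.

Fixpoint hmerge2 m : forall (i : fin m.+1) (X : fin m.+3 -> obj C)
    (f g : chain X), (forall j, hom2 (f j) (g j)) ->
    forall j, hom2 (hmerge i f j) (hmerge i g j) :=
  match m with
  | 0 => fun i =>
      match i with
      | None => fun X f g s j =>
          match j with
          | None => s None ∘₂ s (Some None)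
          | Some v => match v with end
          end
      | Some v => match v with end
      end
  | p.+1 => fun i =>
      match i with
      | None => fun X f g s j =>
          match j with
          | None => s None ∘₂ s (Some None)
          | Some j' => s (Some (Some j'))
          end
      | Some i' => fun X f g s j =>
          match j with
          | None => s None
          | Some j' =>
            @hmerge2 p i' (fun j => X (Some j)) (fun j => f (Some j))
              (fun j => g (Some j)) (fun j => s (Some j)) j'
          end
      end
  end.

Lemma Cell_hmerge2 m (i : fin m.+1) (X : fin m.+3 -> obj C) (f g : chain X)
    (s : forall j, hom2 (f j) (g j)) :
  Cell (bigcomp2 (hmerge2 i s)) = Cell (bigcomp2 s).
Proof.
elim: m i X f g s => [|m IHm] [i|] X f g s //=.
- by apply: Cell_hcomp => //; exact: IHm.
- by rewrite -hcompA.
Qed.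

Lemma Arr_hmerge m (i : fin m.+1) (X : fin m.+3 -> obj C) (f : chain X) :
  Arr (bigcomp (hmerge i f)) = Arr (bigcomp f).
Proof. exact: Cell_dom (Cell_hmerge2 i (fun j => id2 (f j))). Qed.

Lemma Cell_bigcomp2_last m (X : fin m.+3 -> obj C) (f g : chain X)
    (s : forall j, hom2 (f j) (g j)) :
  Cell (@bigcomp2 K C m (fun j => X (fwiden j)) (fun j => f (fwiden j))
          (fun j => g (fwiden j)) (fun j => s (fwiden j)) ∘₂ s (fmax m.+1)) =
  Cell (bigcomp2 s).
Proof.
elim: m X f g s => [|m IHm] X f g s //=.
rewrite -hcompA; apply: Cell_hcomp => //.
exact: (IHm (fun j => X (Some j)) (fun j => f (Some j)) (fun j => g (Some j))
  (fun j => s (Some j))).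
Qed.

Lemma Arr_bigcomp_last m (X : fin m.+3 -> obj C) (f : chain X) :
  Arr (@bigcomp K C m (fun j => X (fwiden j)) (fun j => f (fwiden j))
         ∘ f (fmax m.+1)) = Arr (bigcomp f).
Proof. exact: Cell_dom (Cell_bigcomp2_last (fun j => id2 (f j))). Qed.

End CompositeTheory.

Section TupleTheory.
Variables (K : pzRingType) (C : linear_gray_semigroup K).

Lemma eq_tens2l (X X' Y Y' : obj C) (f f' : hom X X') (g g' : hom Y Y')
  (s s' : hom2 f f') (t : hom2 g g') : s = s' -> s ⊗₂ t = s' ⊗₂ t.
Proof. by move=> ->. Qed.

Lemma eq_tens2r (X X' Y Y' : obj C) (f f' : hom X X') (g g' : hom Y Y')
  (s : hom2 f f') (t t' : hom2 g g') : t = t' -> s ⊗₂ t = s ⊗₂ t'.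
Proof. by move=> ->. Qed.

Lemma Cell_tens2 (X1 X2 X1' X2' Y1 Y2 Y1' Y2' : obj C)
    (f g : hom X1 Y1) (f' g' : hom X1' Y1') (h k : hom X2 Y2)
    (h' k' : hom X2' Y2')
    (s : hom2 f g) (t : hom2 h k) (s' : hom2 f' g') (t' : hom2 h' k') :
  Cell s = Cell s' -> Cell t = Cell t' -> Cell (s ⊗₂ t) = Cell (s' ⊗₂ t').
Proof. by move=> Es Et; cell_subst Es; cell_subst Et. Qed.

Lemma Cell_bigtens2 n (X Y X' Y' : fin n.+1 -> obj C)
    (f g : forall k, hom (X k) (Y k)) (f' g' : forall k, hom (X' k) (Y' k))
    (s : forall k, hom2 (f k) (g k)) (s' : forall k, hom2 (f' k) (g' k)) :
  (forall k, Cell (s k) = Cell (s' k)) -> Cell (bigtens2 s) = Cell (bigtens2 s').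
Proof.
elim: n X Y X' Y' f g f' g' s s' => [|n IHn] X Y X' Y' f g f' g' s s' E /=.
  exact: E.
by apply: Cell_tens2; [exact: E | apply: IHn => k; exact: E].
Qed.

Lemma Arr_bigtens n (X Y X' Y' : fin n.+1 -> obj C)
    (f : forall k, hom (X k) (Y k)) (f' : forall k, hom (X' k) (Y' k)) :
  (forall k, Arr (f k) = Arr (f' k)) -> Arr (bigtens f) = Arr (bigtens f').
Proof.
move=> E; apply: (@Cell_dom _ _ _ _ _ _ _ _ _ _ (bigtens2 (fun j => id2 (f j)))
  (bigtens2 (fun j => id2 (f' j)))).
by apply: Cell_bigtens2 => j; exact: Cell_id2.
Qed.

Lemma bigtens2V n (X Y : fin n.+1 -> obj C) (f g h : forall k, hom (X k) (Y k))
    (t : forall k, hom2 (g k) (h k)) (s : forall k, hom2 (f k) (g k)) :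
  bigtens2 (fun k => t k ⋅ s k) = bigtens2 t ⋅ bigtens2 s.
Proof.
by elim: n X Y f g h t s => [|n IHn] X Y f g h t s //=; rewrite -tens2V -IHn.
Qed.

Fixpoint vmerge2 n : forall (i : fin n.+1) (X Y : fin n.+2 -> obj C)
    (f g : forall k, hom (X k) (Y k)), (forall k, hom2 (f k) (g k)) ->
    forall k, hom2 (vmerge i f k) (vmerge i g k) :=
  match n with
  | 0 => fun i X Y f g s k => s None ⊗₂ s (Some None)
  | p.+1 => fun i X Y f g s k =>
      match i, k with
      | None, None => s None ⊗₂ s (Some None)
      | None, Some k' => s (Some (Some k'))
      | Some i', None => s None
      | Some i', Some k' =>
          @vmerge2 p i' (fun k => X (Some k)) (fun k => Y (Some k))
            (fun k => f (Some k)) (fun k => g (Some k)) (fun k => s (Some k)) k'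
      end
  end.

Lemma Cell_vmerge2 n (i : fin n.+1) (X Y : fin n.+2 -> obj C)
    (f g : forall k, hom (X k) (Y k)) (s : forall k, hom2 (f k) (g k)) :
  Cell (bigtens2 (vmerge2 i s)) = Cell (bigtens2 s).
Proof.
elim: n i X Y f g s => [|n IHn] [i|] X Y f g s //=.
- by apply: Cell_tens2 => //; exact: IHn.
- by rewrite -tens2A.
Qed.

Lemma Arr_vmerge n (i : fin n.+1) (X Y : fin n.+2 -> obj C)
    (f : forall k, hom (X k) (Y k)) :
  Arr (bigtens (vmerge i f)) = Arr (bigtens f).
Proof. exact: Cell_dom (Cell_vmerge2 i (fun k => id2 (f k))). Qed.

Lemma Cell_bigtens2_last n (X Y : fin n.+2 -> obj C)
    (f g : forall k, hom (X k) (Y k)) (s : forall k, hom2 (f k) (g k)) :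
  Cell (@bigtens2 K C n (fun k => X (fwiden k)) (fun k => Y (fwiden k))
          (fun k => f (fwiden k)) (fun k => g (fwiden k))
          (fun k => s (fwiden k)) ⊗₂ s (fmax n.+1)) = Cell (bigtens2 s).
Proof.
elim: n X Y f g s => [|n IHn] X Y f g s //=.
rewrite -tens2A; apply: Cell_tens2 => //.
exact: (IHn (fun j => X (Some j)) (fun j => Y (Some j)) (fun j => f (Some j))
  (fun j => g (Some j)) (fun j => s (Some j))).
Qed.

Lemma Arr_bigtens_last n (X Y : fin n.+2 -> obj C)
    (f : forall k, hom (X k) (Y k)) :
  Arr (@bigtens K C n (fun k => X (fwiden k)) (fun k => Y (fwiden k))
         (fun k => f (fwiden k)) ⊗ f (fmax n.+1)) = Arr (bigtens f).
Proof. exact: Cell_dom (Cell_bigtens2_last (fun k => id2 (f k))). Qed.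

Lemma Theta2_natural m (X Y : fin m.+2 -> obj C) (f f' : chain X)
    (g g' : chain Y) (s : forall j, hom2 (f j) (f' j))
    (t : forall j, hom2 (g j) (g' j)) :
  Theta2 f' g' ⋅ bigcomp2 (f := chain_tens f g) (g := chain_tens f' g')
                   (fun j => s j ⊗₂ t j) =
  (bigcomp2 s ⊗₂ bigcomp2 t) ⋅ Theta2 f g.
Proof.
elim: m X Y f f' g g' s t => [|m IHm] X Y f f' g g' s t /=.
  by rewrite vcomp1s vcomps1.
rewrite -vcompA -hcompV vcomp1s IHm -[s None ⊗₂ t None]vcomps1 hcompV.
by rewrite !vcompA that_natural.
Qed.

Lemma Theta_2E m (X : fin m.+2 -> fin 2 -> obj C) (f : grid X) :
  Theta f = Theta2 (col f None) (col f (Some None)).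
Proof. by rewrite /= tens2_11 vcomp1s. Qed.

Lemma Theta_natural m n (X : fin m.+2 -> fin n.+1 -> obj C) (f f' : grid X)
    (s : forall j k, hom2 (f j k) (f' j k)) :
  Theta f' ⋅ row_tens2 s = col_comp2 s ⋅ Theta f.
Proof.
elim: n X f f' s => [|n IHn] X f f' s /=; first by rewrite vcomp1s vcomps1.
rewrite -vcompA (Theta2_natural (f := col f None) (f' := col f' None)
  (g := row_tens (del_first_col f)) (g' := row_tens (del_first_col f'))
  (fun j => s j None) (fun j => bigtens2 (fun k => s j (Some k)))).
rewrite !vcompA -!tens2V vcomp1s.
rewrite (IHn _ (del_first_col f) (del_first_col f') (fun j k => s j (Some k))).
by rewrite vcomps1.
Qed.

Lemma Theta_pair_natural n (X Y Z : fin n.+1 -> obj C)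
    (g g' : forall k, hom (Y k) (Z k)) (f f' : forall k, hom (X k) (Y k))
    (t : forall k, hom2 (g k) (g' k)) (s : forall k, hom2 (f k) (f' k)) :
  Theta_pair g' f' ⋅ (bigtens2 t ∘₂ bigtens2 s) =
  bigtens2 (fun k => t k ∘₂ s k) ⋅ Theta_pair g f.
Proof.
pose st (j : fin 2) k : hom2 (grid2 g f j k) (grid2 g' f' j k) :=
  match j with
  | None => t k | Some None => s k | Some (Some v) => match v with end
  end.
exact: (Theta_natural st).
Qed.

Lemma hmerge_Theta_natural m n (i : fin m.+1)
    (X : fin m.+3 -> fin n.+1 -> obj C) (f f' : grid X)
    (s : forall j k, hom2 (f j k) (f' j k)) (j : fin m.+1) :
  hmerge_Theta i f' j
    ⋅ hmerge2 i (f := row_tens f) (g := row_tens f') (fun j => bigtens2 (s j)) j =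
  bigtens2 (fun k => hmerge2 i (f := col f k) (g := col f' k) (fun j => s j k) j)
    ⋅ hmerge_Theta i f j.
Proof.
elim: m i X f f' s j => [|m IHm] [i|] X f f' s [j|] //=;
  rewrite ?vcomp1s ?vcomps1 //; try exact: Theta_pair_natural.
exact: (IHm i _ (del_first_row f) (del_first_row f') (fun j k => s (Some j) k)).
Qed.

Lemma vmerge_Theta_natural m n (i : fin n.+1)
    (X : fin m.+2 -> fin n.+2 -> obj C) (f f' : grid X)
    (s : forall j k, hom2 (f j k) (f' j k)) (k : fin n.+1) :
  vmerge_Theta i f' k
    ⋅ bigcomp2 (f := col (grid_vmerge i f) k) (g := col (grid_vmerge i f') k)
        (fun j => vmerge2 i (s j) k) =
  vmerge2 i (f := col_comp f) (g := col_comp f')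
    (fun k => bigcomp2 (f := col f k) (g := col f' k) (fun j => s j k)) k
    ⋅ vmerge_Theta i f k.
Proof.
elim: n i X f f' s k => [|n IHn] [i|] X f f' s [k|] //=;
  rewrite ?vcomp1s ?vcomps1 //.
- exact: (Theta2_natural (f := col f None) (f' := col f' None)
    (g := col f (Some None)) (g' := col f' (Some None))).
- exact: (IHn i _ (del_first_col f) (del_first_col f') (fun j k => s j (Some k))).
- exact: (Theta2_natural (f := col f None) (f' := col f' None)
    (g := col f (Some None)) (g' := col f' (Some None))).
Qed.

End TupleTheory.

Section Cochains.
Variables (K : comPzRingType) (C : linear_gray_semigroup K).

Definition family m n : Type :=
  forall (X : fin m.+2 -> fin n.+1 -> obj C) (f : grid X),
    hom2 (gdom f) (gcod f).

Definition natural m n (phi : family m n) : Prop :=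
  forall (X : fin m.+2 -> fin n.+1 -> obj C) (f g : grid X)
    (s : forall j k, hom2 (f j k) (g j k)),
    phi X g ⋅ row_tens2 s = col_comp2 s ⋅ phi X f.

(* [cochain m n] is X^{m,n}: m + 1 rows and n + 1 columns. *)
Record cochain m n := Cochain {
  cofun :> forall (X : fin m.+2 -> fin n.+1 -> obj C) (f : grid X),
    hom2 (gdom f) (gcod f);
  cofun_natural : natural cofun
}.

Lemma cochain_eq m n (phi psi : cochain m n) :
  (forall X (f : grid X), phi X f = psi X f) -> phi = psi.
Proof.
case: phi psi => [phi nphi] [psi npsi] /= E.
have {}E : phi = psi by apply: functional_extensionality_dep => X;
  apply: functional_extensionality_dep => f; exact: E.
by subst psi; rewrite (Prop_irrelevance nphi npsi).
Qed.

Section Linear.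
Variables (U V : lmodType K) (h : U -> V) (lh : linear h).
Lemma linear_fun0 : h 0 = 0.
Proof. by have := lh (-1) 0 0; rewrite scaler0 add0r scaleN1r addNr. Qed.
Lemma linear_funD u v : h (u + v) = h u + h v.
Proof. by have := lh 1 u v; rewrite !scale1r. Qed.
Lemma linear_funZ a u : h (a *: u) = a *: h u.
Proof. by have := lh a u 0; rewrite linear_fun0 !addr0. Qed.
Lemma linear_funN u : h (- u) = - h u.
Proof. by rewrite -!scaleN1r linear_funZ. Qed.
End Linear.

Lemma altsum_linear (V : lmodType K) (I : finType) (e : I -> K) (b a : K)
    (x x' z z' : V) (y y' : I -> V) :
  (a *: x + x') + \sum_i e i *: (a *: y i + y' i) + b *: (a *: z + z') =
  a *: (x + \sum_i e i *: y i + b *: z) + (x' + \sum_i e i *: y' i + b *: z').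
Proof.
rewrite !scalerDr [RHS]addrACA [X in _ = X + _]addrACA scaler_sumr -big_split.
congr (_ + _ + (_ + _)); last by rewrite !scalerA mulrC.
by apply: eq_bigr => i _; rewrite scalerDr !scalerA mulrC.
Qed.

Lemma natural0 m n : natural (fun X (f : @grid K C m n X) => 0).
Proof.
move=> X f g s; rewrite (linear_fun0 (vcomp_linearl (row_tens2 s))).
by rewrite (linear_fun0 (vcomp_linearr (col_comp2 s))).
Qed.

Lemma naturalD m n (phi psi : family m n) :
  natural phi -> natural psi -> natural (fun X f => phi X f + psi X f).
Proof.
move=> nphi npsi X f g s; rewrite (linear_funD (vcomp_linearl (row_tens2 s))).
by rewrite (linear_funD (vcomp_linearr (col_comp2 s))) nphi npsi.
Qed.

Lemma naturalZ m n a (phi : family m n) :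
  natural phi -> natural (fun X f => a *: phi X f).
Proof.
move=> nphi X f g s; rewrite (linear_funZ (vcomp_linearl (row_tens2 s))).
by rewrite (linear_funZ (vcomp_linearr (col_comp2 s))) nphi.
Qed.

Lemma naturalN m n (phi : family m n) :
  natural phi -> natural (fun X f => - phi X f).
Proof.
move=> nphi X f g s; rewrite (linear_funN (vcomp_linearl (row_tens2 s))).
by rewrite (linear_funN (vcomp_linearr (col_comp2 s))) nphi.
Qed.

Lemma natural_sum m n (I : finType) (phi : I -> family m n) :
  (forall i, natural (phi i)) -> natural (fun X f => \sum_i phi i X f).
Proof.
move=> nphi X f g s.
elim: (index_enum I) => [|i r IHr]; first by rewrite !big_nil natural0.
rewrite !big_cons (linear_funD (vcomp_linearl (row_tens2 s))) nphi IHr.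
by rewrite (linear_funD (vcomp_linearr (col_comp2 s))).
Qed.

Definition cochain_zero m n : cochain m n := Cochain (@natural0 m n).
Definition cochain_add m n (phi psi : cochain m n) : cochain m n :=
  Cochain (naturalD (@cofun_natural _ _ phi) (@cofun_natural _ _ psi)).
Definition cochain_opp m n (phi : cochain m n) : cochain m n :=
  Cochain (naturalN (@cofun_natural _ _ phi)).
Definition cochain_scale m n (a : K) (phi : cochain m n) : cochain m n :=
  Cochain (naturalZ a (@cofun_natural _ _ phi)).

Section Instances.
Variables m n : nat.

HB.instance Definition _ := gen_eqMixin (cochain m n).
HB.instance Definition _ := gen_choiceMixin (cochain m n).

Fact cochain_addA : associative (@cochain_add m n).
Proof. by move=> p q r; apply: cochain_eq => X f; exact: addrA. Qed.
Fact cochain_addC : commutative (@cochain_add m n).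
Proof. by move=> p q; apply: cochain_eq => X f; exact: addrC. Qed.
Fact cochain_add0 : left_id (cochain_zero m n) (@cochain_add m n).
Proof. by move=> p; apply: cochain_eq => X f; exact: add0r. Qed.
Fact cochain_addN :
  left_inverse (cochain_zero m n) (@cochain_opp m n) (@cochain_add m n).
Proof. by move=> p; apply: cochain_eq => X f; exact: addNr. Qed.

HB.instance Definition _ := GRing.isZmodule.Build (cochain m n)
  cochain_addA cochain_addC cochain_add0 cochain_addN.

Fact cochain_scaleA (a b : K) (p : cochain m n) :
  cochain_scale a (cochain_scale b p) = cochain_scale (a * b) p.
Proof. by apply: cochain_eq => X f; exact: scalerA. Qed.
Fact cochain_scale1 : left_id (1 : K) (@cochain_scale m n).
Proof. by move=> p; apply: cochain_eq => X f; exact: scale1r. Qed.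
Fact cochain_scaleDr : right_distributive (@cochain_scale m n) +%R.
Proof. by move=> a p q; apply: cochain_eq => X f; exact: scalerDr. Qed.
Fact cochain_scaleDl (p : cochain m n) :
  {morph (@cochain_scale m n)^~ p : a b / a + b}.
Proof. by move=> a b; apply: cochain_eq => X f; exact: scalerDl. Qed.

HB.instance Definition _ := GRing.Zmodule_isLmodule.Build K (cochain m n)
  cochain_scaleA cochain_scale1 cochain_scaleDr cochain_scaleDl.

Lemma cochainDE (p q : cochain m n) X (f : grid X) :
  (p + q) X f = p X f + q X f.
Proof. by []. Qed.
Lemma cochainZE a (p : cochain m n) X (f : grid X) : (a *: p) X f = a *: p X f.
Proof. by []. Qed.
Lemma cochain0E X (f : grid X) : (0 : cochain m n) X f = 0.
Proof. by []. Qed.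
End Instances.

Section HorizontalDifferential.
Variables m n : nat.
Implicit Types (phi : family m n) (X : fin m.+3 -> fin n.+1 -> obj C).

Definition dh_first phi X (f : grid X) : hom2 (gdom f) (gcod f) :=
  Theta_pair (f None) (col_comp (del_first_row f))
  ⋅ (id2 (row_tens f None) ∘₂ phi _ (del_first_row f)).

Lemma dh_inner_par i X (f : grid X) :
  Par (bigcomp (hmerge i (row_tens f))) (gcod (grid_hmerge i f)) =
  Par (gdom f) (gcod f).
Proof.
apply: Par_eq; first exact: Arr_hmerge.
by apply: Arr_bigtens => k; exact: Arr_hmerge.
Qed.

Definition dh_inner phi i X (f : grid X) : hom2 (gdom f) (gcod f) :=
  cast (dh_inner_par i f)
    (phi _ (grid_hmerge i f) ⋅ bigcomp2 (hmerge_Theta i f)).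

Lemma dh_last_par X (f : grid X) :
  Par (gdom (del_last_row f) ∘ row_tens f (fmax m.+1))
      (bigtens (fun k => col_comp (del_last_row f) k ∘ f (fmax m.+1) k)) =
  Par (gdom f) (gcod f).
Proof.
apply: Par_eq; first exact: Arr_bigcomp_last (row_tens f).
by apply: Arr_bigtens => k; exact: Arr_bigcomp_last (col f k).
Qed.

Definition dh_last phi X (f : grid X) : hom2 (gdom f) (gcod f) :=
  cast (dh_last_par f)
    (Theta_pair (col_comp (del_last_row f)) (f (fmax m.+1))
     ⋅ (phi _ (del_last_row f) ∘₂ id2 (row_tens f (fmax m.+1)))).

(* [i : fin m.+1] stands for the index i + 1 of the alternating sum. *)
Definition dh phi : family m.+1 n := fun X f =>
  dh_first phi f
  + \sum_(i : fin m.+1) (-1) ^+ (fval i).+1 *: dh_inner phi i f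
  + (-1) ^+ m.+2 *: dh_last phi f.

Lemma dh_first_natural phi : natural phi -> natural (dh_first phi).
Proof.
move=> nphi X f g s.
pose s' j k := s (Some j) k.
rewrite /dh_first -vcompA.
have -> : (id2 (row_tens g None) ∘₂ phi _ (del_first_row g)) ⋅ row_tens2 s =
    (bigtens2 (s None) ∘₂ col_comp2 (f := del_first_row f) s')
    ⋅ (id2 (row_tens f None) ∘₂ phi _ (del_first_row f)).
  by rewrite -!hcompV vcomp1s vcomps1 -(nphi _ _ _ s').
rewrite !vcompA; apply: eq_vcompl.
exact: (Theta_pair_natural (f := col_comp (del_first_row f))
  (f' := col_comp (del_first_row g)) (s None)
  (fun k => bigcomp2 (f := col (del_first_row f) k)
     (g := col (del_first_row g) k) (fun j => s' j k))).
Qed.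

Lemma dh_inner_natural phi i :
  natural phi -> natural (fun X f => dh_inner phi i f).
Proof.
move=> nphi X f g s; apply: Cell_inj.
pose s' j k : hom2 (grid_hmerge i f j k) (grid_hmerge i g j k) :=
  hmerge2 i (f := col f k) (g := col g k) (fun j => s j k) j.
pose r j : hom2 (row_tens f j) (row_tens g j) := bigtens2 (s j).
have Er : Cell (row_tens2 s) = Cell (bigcomp2 (hmerge2 i r)).
  by rewrite (Cell_hmerge2 i r).
have Ec : Cell (col_comp2 s) = Cell (col_comp2 s').
  apply: Cell_bigtens2 => k.
  by rewrite -(Cell_hmerge2 i (f := col f k) (g := col g k) (fun j => s j k)).
rewrite (Cell_vcomp (Cell_cast (dh_inner_par i g) _) Er).
rewrite (Cell_vcomp Ec (Cell_cast (dh_inner_par i f) _)).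
rewrite -vcompA -bigcomp2V vcompA -nphi -vcompA /row_tens2 -bigcomp2V.
apply: Cell_vcomp => //; apply: Cell_bigcomp2 => j.
by rewrite hmerge_Theta_natural.
Qed.

Lemma dh_last_natural phi : natural phi -> natural (dh_last phi).
Proof.
move=> nphi X f g s; apply: Cell_inj.
pose s' j k := s (fwiden j) k.
pose r j : hom2 (row_tens f j) (row_tens g j) := bigtens2 (s j).
pose c k : hom2 (col_comp (del_last_row f) k) (col_comp (del_last_row g) k) :=
  bigcomp2 (f := col (del_last_row f) k) (g := col (del_last_row g) k)
    (fun j => s' j k).
have Er : Cell (row_tens2 s) =
    Cell (row_tens2 (f := del_last_row f) (g := del_last_row g) s'
          ∘₂ r (fmax m.+1)).
  by rewrite -(Cell_bigcomp2_last r).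
have Ec : Cell (col_comp2 s) = Cell (bigtens2 (fun k => c k ∘₂ s (fmax m.+1) k)).
  apply: Cell_bigtens2 => k.
  exact: (esym (Cell_bigcomp2_last (f := col f k) (g := col g k)
    (fun j => s j k))).
rewrite (Cell_vcomp (Cell_cast (dh_last_par g) _) Er).
rewrite (Cell_vcomp Ec (Cell_cast (dh_last_par f) _)).
rewrite -vcompA -hcompV (nphi _ _ _ s') vcomp1s.
rewrite -[r (fmax m.+1)]vcomps1 hcompV !vcompA; apply: (f_equal (@Cell K C _ _ _ _)); apply: eq_vcompl.
exact: (Theta_pair_natural c (s (fmax m.+1))).
Qed.

Lemma dh_natural phi : natural phi -> natural (dh phi).
Proof.
move=> nphi; apply: naturalD; last first.
  exact: naturalZ (dh_last_natural nphi).
apply: naturalD; first exact: dh_first_natural.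
by apply: natural_sum => i; apply: naturalZ; exact: dh_inner_natural.
Qed.

Lemma dh_linear_at a phi psi X (f : grid X) :
  dh (fun Y g => a *: phi Y g + psi Y g) f = a *: dh phi f + dh psi f.
Proof.
rewrite /dh -altsum_linear; congr (_ + _ + _ *: _).
- by rewrite /dh_first hcomp_linearr vcomp_linearr.
- apply: eq_bigr => i _.
  by congr (_ *: _); rewrite /dh_inner vcomp_linearl cast_linear.
- by rewrite /dh_last hcomp_linearl vcomp_linearr cast_linear.
Qed.
End HorizontalDifferential.

Section VerticalDifferential.
Variables m n : nat.
Implicit Types (phi : family m n) (X : fin m.+2 -> fin n.+2 -> obj C).

Definition dv_first phi X (f : grid X) : hom2 (gdom f) (gcod f) :=
  (id2 (col_comp f None) ⊗₂ phi _ (del_first_col f))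
  ⋅ Theta2 (col f None) (row_tens (del_first_col f)).

Lemma dv_inner_par i X (f : grid X) :
  Par (gdom (grid_vmerge i f)) (bigtens (vmerge i (col_comp f))) =
  Par (gdom f) (gcod f).
Proof.
apply: Par_eq; last exact: Arr_vmerge.
by apply: Arr_bigcomp => j; exact: Arr_vmerge.
Qed.

Definition dv_inner phi i X (f : grid X) : hom2 (gdom f) (gcod f) :=
  cast (dv_inner_par i f)
    (bigtens2 (vmerge_Theta i f) ⋅ phi _ (grid_vmerge i f)).

Lemma dv_last_par X (f : grid X) :
  Par (bigcomp (chain_tens (row_tens (del_last_col f)) (col f (fmax n.+1))))
      (gcod (del_last_col f) ⊗ col_comp f (fmax n.+1)) =
  Par (gdom f) (gcod f).
Proof.
apply: Par_eq; last exact: Arr_bigtens_last (col_comp f).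
by apply: Arr_bigcomp => j; exact: Arr_bigtens_last (f j).
Qed.

Definition dv_last phi X (f : grid X) : hom2 (gdom f) (gcod f) :=
  cast (dv_last_par f)
    ((phi _ (del_last_col f) ⊗₂ id2 (col_comp f (fmax n.+1)))
     ⋅ Theta2 (row_tens (del_last_col f)) (col f (fmax n.+1))).

(* [i : fin n.+1] stands for the index i + 1 of the alternating sum. *)
Definition dv phi : family m n.+1 := fun X f =>
  dv_first phi f
  + \sum_(i : fin n.+1) (-1) ^+ (fval i).+1 *: dv_inner phi i f
  + (-1) ^+ n.+2 *: dv_last phi f.

Lemma dv_first_natural phi : natural phi -> natural (dv_first phi).
Proof.
move=> nphi X f g s.
pose s' j k := s j (Some k).
pose c := bigcomp2 (f := col f None) (g := col g None) (fun j => s j None).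
rewrite /dv_first -vcompA (Theta2_natural (f := col f None) (f' := col g None)
  (g := row_tens (del_first_col f)) (g' := row_tens (del_first_col g))
  (fun j => s j None) (fun j => bigtens2 (s' j))).
rewrite !vcompA; apply: eq_vcompl; rewrite -[RHS]tens2V -tens2V vcomp1s vcomps1.
by apply: eq_tens2r; exact: nphi.
Qed.

Lemma dv_inner_natural phi i :
  natural phi -> natural (fun X f => dv_inner phi i f).
Proof.
move=> nphi X f g s; apply: Cell_inj.
pose s' j k : hom2 (grid_vmerge i f j k) (grid_vmerge i g j k) :=
  vmerge2 i (s j) k.
pose c k : hom2 (col_comp f k) (col_comp g k) :=
  bigcomp2 (f := col f k) (g := col g k) (fun j => s j k).
have Er : Cell (row_tens2 s) = Cell (row_tens2 s').
  by apply: Cell_bigcomp2 => j; rewrite -(Cell_vmerge2 i (s j)).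
have Ec : Cell (col_comp2 s) = Cell (bigtens2 (vmerge2 i c)).
  by rewrite (Cell_vmerge2 i c).
rewrite (Cell_vcomp (Cell_cast (dv_inner_par i g) _) Er).
rewrite (Cell_vcomp Ec (Cell_cast (dv_inner_par i f) _)).
rewrite -vcompA nphi !vcompA /col_comp2 -!bigtens2V.
apply: Cell_vcomp => //; apply: Cell_bigtens2 => k.
by rewrite vmerge_Theta_natural.
Qed.

Lemma dv_last_natural phi : natural phi -> natural (dv_last phi).
Proof.
move=> nphi X f g s; apply: Cell_inj.
pose s' j k := s j (fwiden k).
pose c k : hom2 (col_comp f k) (col_comp g k) :=
  bigcomp2 (f := col f k) (g := col g k) (fun j => s j k).
have Er : Cell (row_tens2 s) = Cell (bigcomp2
    (f := chain_tens (row_tens (del_last_col f)) (col f (fmax n.+1)))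
    (g := chain_tens (row_tens (del_last_col g)) (col g (fmax n.+1)))
    (fun j => bigtens2 (s' j) ⊗₂ s j (fmax n.+1))).
  by apply: Cell_bigcomp2 => j; exact: (esym (Cell_bigtens2_last (s j))).
have Ec : Cell (col_comp2 s) = Cell (col_comp2 (f := del_last_col f)
    (g := del_last_col g) s' ⊗₂ c (fmax n.+1)).
  exact: (esym (Cell_bigtens2_last c)).
rewrite (Cell_vcomp (Cell_cast (dv_last_par g) _) Er).
rewrite (Cell_vcomp Ec (Cell_cast (dv_last_par f) _)).
rewrite -vcompA (Theta2_natural (f := row_tens (del_last_col f))
  (f' := row_tens (del_last_col g)) (g := col f (fmax n.+1))
  (g' := col g (fmax n.+1)) (fun j => bigtens2 (s' j))
  (fun j => s j (fmax n.+1))).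
rewrite !vcompA; apply: (f_equal (@Cell K C _ _ _ _)); apply: eq_vcompl; rewrite -[RHS]tens2V -tens2V.
by rewrite vcomp1s vcomps1; apply: eq_tens2l; exact: nphi.
Qed.

Lemma dv_natural phi : natural phi -> natural (dv phi).
Proof.
move=> nphi; apply: naturalD; last first.
  exact: naturalZ (dv_last_natural nphi).
apply: naturalD; first exact: dv_first_natural.
by apply: natural_sum => i; apply: naturalZ; exact: dv_inner_natural.
Qed.

Lemma dv_linear_at a phi psi X (f : grid X) :
  dv (fun Y g => a *: phi Y g + psi Y g) f = a *: dv phi f + dv psi f.
Proof.
rewrite /dv -altsum_linear; congr (_ + _ + _ *: _).
- by rewrite /dv_first tens2_linearr vcomp_linearl.
- apply: eq_bigr => i _.
  by congr (_ *: _); rewrite /dv_inner vcomp_linearr cast_linear.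
- by rewrite /dv_last tens2_linearl vcomp_linearl cast_linear.
Qed.
End VerticalDifferential.

Section Differentials.
Variables m n : nat.

Definition delta_h (phi : cochain m n) : cochain m.+1 n :=
  Cochain (dh_natural (@cofun_natural _ _ phi)).

Definition delta_v (phi : cochain m n) : cochain m n.+1 :=
  Cochain (dv_natural (@cofun_natural _ _ phi)).

Fact delta_h_is_linear : linear delta_h.
Proof. by move=> a phi psi; apply: cochain_eq => X f; exact: dh_linear_at. Qed.

Fact delta_v_is_linear : linear delta_v.
Proof. by move=> a phi psi; apply: cochain_eq => X f; exact: dv_linear_at. Qed.

HB.instance Definition _ := GRing.isLinear.Build K (cochain m n)
  (cochain m.+1 n) _ delta_h delta_h_is_linear.
HB.instance Definition _ := GRing.isLinear.Build K (cochain m n)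
  (cochain m n.+1) _ delta_v delta_v_is_linear.

End Differentials.

End Cochains.

Definition double_complex (K : pzRingType) (A : nat -> nat -> lmodType K)
    (dh : forall m n, {linear A m n -> A m.+1 n})
    (dv : forall m n, {linear A m n -> A m n.+1}) : Prop :=
  [/\ forall m n (a : A m n), dh m.+1 n (dh m n a) = 0,
      forall m n (a : A m n), dv m n.+1 (dv m n a) = 0
    & forall m n (a : A m n), dh m n.+1 (dv m n a) = dv m.+1 n (dh m n a)].

(* Main.v *)
(* Dividing a cochain phi by the canonical isomorphism Theta turns it into a
   family psi(f) of endomorphisms of c^1 (x) ... (x) c^n, and the summands of
   delta_h and delta_v become simple cofaces: an inner horizontal one is
   psi(merged rows), the outer vertical ones are 1 (x) psi and psi (x) 1,
     and the
   others are conjugation of 1 o psi, psi o 1 or psi(merged columns) by a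
   canonical isomorphism.  The cosimplicial identities in each direction and the
   commutation of horizontal with vertical cofaces thus only compare canonical
   isomorphisms, which agree because Theta factors through every first, last or
   merged row or column.  Naturality of phi enters only when an inner horizontal
   coface is exchanged with an inner vertical one. *)

Require Import Defs.
From HB Require Import structures.
From mathcomp Require Import all_boot all_algebra.
From mathcomp Require Import boolp.
Import Defs.

Set Implicit Arguments.
Unset Strict Implicit.
Unset Printing Implicit Defensive.

Import GRing.Theory.
Local Open Scope ring_scope.
Local Open Scope cell_scope.

(** * Partially defined composition of 2-morphisms *)

Section PartialCells.
Variables (K : pzRingType) (C : linear_2category K).

(** Composition and tensor product are associative only up to propositional equality of boundaries,
    so most identities relate 2-morphisms of different types. In [ocell] they become plain equations
    that can be rewritten with; the price is a definedness condition in each interchange law.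
    Inverses of canonical isomorphisms are never named. [conjugates x a b] says that x is invertible
    and that b after x equals x after a, so b is determined by x and a ([conj_uniq]). An identity
    between cofaces thus splits into an equation between the conjugating cells x and one between the
    cells a being conjugated. Naturality is forced in a single place because merging rows i, i + 1
    and columns j, j + 1 in the two orders puts (f' ⊗ g') ∘ (f ⊗ g) or (f' ∘ f) ⊗ (g' ∘ g) in the
    merged entry, and these are only isomorphic. In every other identity the two grids have the same
    arrows, and the values of psi agree by [psi_ext]. *)

Definition ocell := option {p : par C & hom2p p}.

Definition oc (X Y : obj C) (f g : hom X Y) (s : hom2 f g) : ocell :=
  Some (Cell s).

(* Vertical and horizontal composition [vc], [hc] of arbitrary 2-morphisms, with
   the absorbing value [None] when the boundaries do not match: associativity
   then holds without side condition and without transports. *)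
Definition vrel (x y z : ocell) : Prop :=
  exists X Y (f g h : hom X Y) (t : hom2 g h) (s : hom2 f g),
    [/\ x = oc t, y = oc s & z = oc (t ⋅ s)].

Definition hrel (x y z : ocell) : Prop :=
  exists X Y Z (g g' : hom Y Z) (f f' : hom X Y) (t : hom2 g g') (s : hom2 f
    f'),
    [/\ x = oc t, y = oc s & z = oc (t ∘₂ s)].

Definition vc (x y : ocell) : ocell :=
  if pselect (exists z, vrel x y z) is left e then projT1 (cid e) else None.

Definition hc (x y : ocell) : ocell :=
  if pselect (exists z, hrel x y z) is left e then projT1 (cid e) else None.

Lemma oc_inj (X Y : obj C) (f g : hom X Y) (s t : hom2 f g) :
  oc s = oc t -> s = t.
Proof. by move=> /Some_inj /Cell_inj. Qed.

Lemma oc_Cell (X Y X' Y' : obj C) (f g : hom X Y) (f' g' : hom X' Y')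
  (s : hom2 f g) (t : hom2 f' g') : oc s = oc t -> Cell s = Cell t.
Proof. exact: Some_inj. Qed.

Lemma Cell_oc (X Y X' Y' : obj C) (f g : hom X Y) (f' g' : hom X' Y')
  (s : hom2 f g) (t : hom2 f' g') : Cell s = Cell t -> oc s = oc t.
Proof. exact: f_equal. Qed.

Lemma vcE (X Y : obj C) (f g h : hom X Y) (t : hom2 g h) (s : hom2 f g) :
  vc (oc t) (oc s) = oc (t ⋅ s).
Proof.
rewrite /vc; case: pselect => [e|[]]; last first.
  by exists (oc (t ⋅ s)), X, Y, f, g, h, t, s.
case: cid => /= z [X' [Y' [f' [g' [h' [t' [s' [/oc_Cell Et /oc_Cell Es
  ->]]]]]]]].
by apply: Cell_oc; apply: Cell_vcomp.
Qed.

Lemma hcE (X Y Z : obj C) (g g' : hom Y Z) (f f' : hom X Y) (t : hom2 g g')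
  (s : hom2 f f') : hc (oc t) (oc s) = oc (t ∘₂ s).
Proof.
rewrite /hc; case: pselect => [e|[]]; last first.
  by exists (oc (t ∘₂ s)), X, Y, Z, g, g', f, f', t, s.
case: cid => /= z.
move=> [X' [Y' [Z' [k [k' [l [l' [t' [s' [/oc_Cell Et /oc_Cell Es ->]]]]]]]]]].
by apply: Cell_oc; apply: Cell_hcomp.
Qed.

Lemma vcP x y : vc x y <> None -> vrel x y (vc x y).
Proof.
rewrite {1}/vc; case: pselect => // -[z h] _.
by move: h => [X [Y [f [g [k [t [s [-> -> _]]]]]]]]; rewrite vcE; exists X, Y,
  f, g, k, t, s.
Qed.

Lemma hcP x y : hc x y <> None -> hrel x y (hc x y).
Proof.
rewrite {1}/hc; case: pselect => // -[z h] _.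
move: h => [X [Y [Z [g [g' [f [f' [t [s [-> -> _]]]]]]]]]].
by rewrite hcE; exists X, Y, Z, g, g', f, f', t, s.
Qed.

Lemma vcA x y z : vc x (vc y z) = vc (vc x y) z.
Proof.
case: (pselect (vc x (vc y z) = None)) => [E|].
  rewrite E; case: (pselect (vc (vc x y) z = None)) => [-> //|].
  move=> /vcP [X [Y [f [g [h [t [s [E1 Es Et]]]]]]]].
  have /vcP : vc x y <> None by rewrite E1.
  move=> [X' [Y' [f' [g' [h' [t' [s' [E1' Es' Et']]]]]]]].
  move: E E1; rewrite Et' Es E1' Es' => E /oc_Cell Ec.
  have eX := Cell_src Ec; have eY := Cell_tgt Ec; subst X' Y'.
  have ef := Arr_inj (Cell_dom Ec); subst f'.
  by move: E; rewrite !vcE.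
move=> /vcP [X [Y [f [g [h [t [s [Ex E1 E2]]]]]]]].
have /vcP : vc y z <> None by rewrite E1.
move=> [X' [Y' [f' [g' [h' [t' [s' [Ey Ez Et']]]]]]]].
move: E1; rewrite Et' Ex Ey Ez => /oc_Cell Ec.
have eX := Cell_src Ec; have eY := Cell_tgt Ec; subst X' Y'.
have eg := Arr_inj (Cell_cod Ec); subst h'.
by rewrite !vcE vcompA.
Qed.

Lemma hcA x y z : hc x (hc y z) = hc (hc x y) z.
Proof.
case: (pselect (hc x (hc y z) = None)) => [E|].
  rewrite E; case: (pselect (hc (hc x y) z = None)) => [-> //|].
  move=> /hcP [X [Y [Z [g [g' [f [f' [t [s [E1 Es Et]]]]]]]]]].
  have /hcP : hc x y <> None by rewrite E1.
  move=> [X1 [Y1 [Z1 [g1 [g1' [f1 [f1' [t1 [s1 [E1' Es' Et']]]]]]]]]].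
  move: E E1; rewrite Et' Es E1' Es' => E /oc_Cell Ec.
  have eX := Cell_src Ec; subst X1.
  by move: E; rewrite !hcE.
move=> /hcP [X [Y [Z [g [g' [f [f' [t [s [Ex E1 E2]]]]]]]]]].
have /hcP : hc y z <> None by rewrite E1.
move=> [X1 [Y1 [Z1 [g1 [g1' [f1 [f1' [t1 [s1 [Ey Ez Et']]]]]]]]]].
move: E1; rewrite Et' Ex Ey Ez => /oc_Cell Ec.
have eX := Cell_tgt Ec; subst Z1.
by rewrite !hcE; apply: Cell_oc; exact: hcompA.
Qed.

(** The hypotheses exclude an accident: two composite 1-morphisms can coincide although their
    factors do not, and then only the right-hand side is defined. *)
Lemma hc_vc x y x' y' : vc x' x <> None -> vc y' y <> None ->
  hc (vc x' x) (vc y' y) = vc (hc x' y') (hc x y).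
Proof.
move=> /vcP [X [Y [f [g [h [t [s [-> -> ->]]]]]]]].
move=> /vcP [X' [Y' [f' [g' [h' [t' [s' [-> -> ->]]]]]]]].
case: (pselect (hc (oc (t ⋅ s)) (oc (t' ⋅ s')) = None)) => [E|].
  case: (pselect (Y' = X)) => [e|ne].
    by subst Y'; rewrite !hcE vcE hcompV.
  rewrite E; case: (pselect (hc (oc t) (oc t') = None)) => [->|].
    case: (pselect (vc None (hc (oc s) (oc s')) = None)) => // /vcP.
    by move=> [? [? [? [? [? [? [? []]]]]]]].
  move=> /hcP [? [? [? [? [? [? [? [? [? [/oc_Cell E1 /oc_Cell E2 _]]]]]]]]]].
  by case: ne; rewrite (Cell_tgt E2) (Cell_src E1).
move=> /hcP [? [? [? [? [? [? [? [? [? [/oc_Cell E1 /oc_Cell E2 _]]]]]]]]]].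
have e : Y' = X by rewrite (Cell_tgt E2) (Cell_src E1).
by subst Y'; rewrite !hcE vcE hcompV.
Qed.

Lemma is_iso_id (X Y : obj C) (f : hom X Y) : is_iso (id2 f).
Proof. by exists (id2 f); rewrite vcomp1s. Qed.

Lemma is_iso_vcomp (X Y : obj C) (f g h : hom X Y) (t : hom2 g h) (s : hom2 f g)
  :
  is_iso t -> is_iso s -> is_iso (t ⋅ s).
Proof.
move=> [t' [t't tt']] [s' [s's ss']]; exists (s' ⋅ t'); split.
  by rewrite vcompA -[(s' ⋅ t') ⋅ t]vcompA t't vcomps1.
by rewrite vcompA -[(t ⋅ s) ⋅ s']vcompA ss' vcomps1.
Qed.

Lemma is_iso_hcomp (X Y Z : obj C) (g g' : hom Y Z) (f f' : hom X Y)
  (t : hom2 g g') (s : hom2 f f') : is_iso t -> is_iso s -> is_iso (t ∘₂ s).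
Proof.
move=> [t' [t't tt']] [s' [s's ss']]; exists (t' ∘₂ s').
by rewrite -!hcompV t't tt' s's ss' !hcomp11.
Qed.

(** A defined right-hand side forces each solution z to be a 2-morphism, and then z is t composed
    with the inverse r of s. *)
Lemma vc_cancel (x y : ocell) (X Y X' Y' : obj C) (f g : hom X Y) (f' g' : hom
  X' Y')
  (s : hom2 f g) (t : hom2 f' g') :
  is_iso s -> vc x (oc s) = oc t -> vc y (oc s) = oc t -> x = y.
Proof.
move=> [r [_ sr]]; suff K0 z : vc z (oc s) = oc t -> z = vc (oc t) (oc r).
  by move=> /K0 -> /K0 ->.
move=> E; have /vcP : vc z (oc s) <> None by rewrite E.
move=> [X1 [Y1 [f1 [g1 [h1 [t1 [s1 [Ez /oc_Cell Es _]]]]]]]];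
  rewrite -E -vcA vcE sr Ez.
have eX := Cell_src Es; have eY := Cell_tgt Es; subst.
by have eg := Arr_inj (Cell_cod Es); subst; rewrite vcE vcomps1.
Qed.

Definition conjugates (x a b : ocell) : Prop :=
  exists X Y (f g : hom X Y) (s : hom2 f g) (u : hom2 f f) (v : hom2 g g),
    [/\ is_iso s, [/\ x = oc s, a = oc u & b = oc v] & v ⋅ s = s ⋅ u].

Lemma conjI (X Y : obj C) (f g : hom X Y) (s : hom2 f g) (u : hom2 f f)
  (v : hom2 g g) : is_iso s -> v ⋅ s = s ⋅ u -> conjugates (oc s) (oc u) (oc v).
Proof. by move=> si E; exists X, Y, f, g, s, u, v. Qed.

Lemma conj_uniq x a b b' : conjugates x a b -> conjugates x a b' -> b = b'.
Proof.
move=> [X [Y [f [g [s [u [v [si [-> -> ->] E]]]]]]]].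
move=> [X' [Y' [f' [g' [s' [u' [v' [si' [/oc_Cell Es /oc_Cell Eu ->] E']]]]]]]].
apply: (vc_cancel (s := s) (t := v ⋅ s) si); first by rewrite vcE.
have eX := Cell_src Es; have eY := Cell_tgt Es; subst X' Y'.
have ef := Arr_inj (Cell_dom Es); have eg := Arr_inj (Cell_cod Es); subst f' g'.
by rewrite vcE (Cell_inj Es) (Cell_inj Eu) in E E' *; rewrite E E'.
Qed.

Lemma conj_vc x y a b c : conjugates x a b -> conjugates y b c -> conjugates (vc
  y x) a c.
Proof.
move=> [X [Y [f [g [s [u [v [si [-> -> ->] E]]]]]]]].
move=> [X' [Y' [f' [g' [s' [u' [v' [si' [-> /oc_Cell Ev ->] E']]]]]]]].
have eX := Cell_src Ev; have eY := Cell_tgt Ev; subst X' Y'.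
have eg := Arr_inj (Cell_dom Ev); subst f'; move/Cell_inj: Ev => Ev; subst u'.
rewrite vcE; apply: conjI; first exact: is_iso_vcomp.
by rewrite vcompA E' -!vcompA E.
Qed.

(** Composability is required of a and c only: b and d are endomorphisms of 1-morphisms parallel to
    theirs. *)
Lemma conj_hc x y a b c d : conjugates x a b -> conjugates y c d -> hc a c <>
  None ->
  conjugates (hc x y) (hc a c) (hc b d).
Proof.
move=> [X [Y [f [g [s [u [v [si [-> -> ->] E]]]]]]]].
move=> [X' [Y' [f' [g' [s' [u' [v' [si' [-> -> ->] E']]]]]]]].
move=> /hcP [? [? [? [? [? [? [? [? [? [/oc_Cell E1 /oc_Cell E2 _]]]]]]]]]].
have e : Y' = X by rewrite (Cell_tgt E2) (Cell_src E1).
subst Y'; rewrite !hcE; apply: conjI; first exact: is_iso_hcomp.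
by rewrite -!hcompV E E'.
Qed.

Lemma conj_id1 (X Y : obj C) (f : hom X Y) (u : hom2 f f) :
  conjugates (oc (id2 f)) (oc u) (oc u).
Proof. by apply: conjI; [exact: is_iso_id | rewrite vcomp1s vcomps1]. Qed.

Lemma conj_iso1 (X Y : obj C) (f g : hom X Y) (s : hom2 f g) :
  is_iso s -> conjugates (oc s) (oc (id2 f)) (oc (id2 g)).
Proof. by move=> si; apply: conjI => //; rewrite vcomp1s vcomps1. Qed.

End PartialCells.
(** * Coherence of the canonical isomorphisms *)

Section Coherence.
Variables (K : pzRingType) (C : linear_gray_semigroup K).

(** Any two 2-morphisms can be tensored, so no relation on boundaries is needed here, in contrast to
    [vc] and [hc]. *)
Definition tc (x y : ocell C) : ocell C :=
  match x, y with
  | Some a, Some b =>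
      oc (tens2 (f := pdom (projT1 a)) (f' := pcod (projT1 a))
            (g := pdom (projT1 b)) (g' := pcod (projT1 b)) (projT2 a) (projT2
              b))
  | _, _ => None
  end.

Lemma tcE (X Y X' Y' : obj C) (f g : hom X Y) (f' g' : hom X' Y')
  (s : hom2 f g) (t : hom2 f' g') : tc (oc s) (oc t) = oc (s ⊗₂ t).
Proof. by []. Qed.

Lemma tcA (x y z : ocell C) : tc x (tc y z) = tc (tc x y) z.
Proof.
case: x => [[p s]|] //; case: y => [[q t]|] //; case: z => [[r u]|] //=.
apply: Cell_oc; exact: tens2A.
Qed.

Lemma tc_vc (x y x' y' : ocell C) : vc x' x <> None -> vc y' y <> None ->
  tc (vc x' x) (vc y' y) = vc (tc x' y') (tc x y).
Proof.
move=> /vcP [X [Y [f [g [h [t [s [-> -> ->]]]]]]]].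
move=> /vcP [X' [Y' [f' [g' [h' [t' [s' [-> -> ->]]]]]]]].
by rewrite !tcE vcE tens2V.
Qed.

Lemma is_iso_tens2 (X Y X' Y' : obj C) (f g : hom X Y) (f' g' : hom X' Y')
  (s : hom2 f g) (t : hom2 f' g') : is_iso s -> is_iso t -> is_iso (s ⊗₂ t).
Proof.
move=> [s' [s's ss']] [t' [t't tt']]; exists (s' ⊗₂ t').
by rewrite -!tens2V t't tt' s's ss' !tens2_11.
Qed.

Lemma conj_tc (x y a b c d : ocell C) :
  conjugates x a b -> conjugates y c d -> conjugates (tc x y) (tc a c) (tc b d).
Proof.
move=> [X [Y [f [g [s [u [v [si [-> -> ->] E]]]]]]]].
move=> [X' [Y' [f' [g' [s' [u' [v' [si' [-> -> ->] E']]]]]]]].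
rewrite !tcE; apply: conjI; first exact: is_iso_tens2.
by rewrite -!tens2V E E'.
Qed.

Lemma is_iso_Theta2 m (X Y : fin m.+2 -> obj C) (f : chain X) (g : chain Y) :
  is_iso (Theta2 f g).
Proof.
elim: m X Y f g => [|m IHm] X Y f g /=; first exact: is_iso_id.
apply: is_iso_vcomp; first exact: that_iso.
by apply: is_iso_hcomp; [exact: is_iso_id | exact: IHm].
Qed.

Lemma is_iso_Theta m n (X : fin m.+2 -> fin n.+1 -> obj C) (f : grid X) :
  is_iso (Theta f).
Proof.
elim: n X f => [|n IHn] X f /=; first exact: is_iso_id.
apply: is_iso_vcomp; last exact: is_iso_Theta2.
by apply: is_iso_tens2; [exact: is_iso_id | exact: IHn].
Qed.

Lemma Theta_pairS n (X Y Z : fin n.+2 -> obj C)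
    (g : forall k, hom (Y k) (Z k)) (f : forall k, hom (X k) (Y k)) :
  Theta_pair g f =
  (id2 (g None ∘ f None) ⊗₂
     Theta_pair (fun k => g (Some k)) (fun k => f (Some k)))
  ⋅ that (g None) (bigtens (fun k => g (Some k)))
         (f None) (bigtens (fun k => f (Some k))).
Proof.
transitivity ((id2 (g None ∘ f None) ⊗₂
     Theta_pair (fun k => g (Some k)) (fun k => f (Some k)))
  ⋅ (that (g None) (bigtens (fun k => g (Some k)))
         (f None) (bigtens (fun k => f (Some k))) ⋅
           (id2 (g None ⊗ bigtens (fun k => g (Some k))) ∘₂ id2 (f None ⊗
           bigtens (fun k => f (Some k)))))).
  reflexivity.
by rewrite hcomp11 vcomps1.
Qed.

Lemma hcomp_idl (X Y Z : obj C) (g : hom Y Z) (f f' f'' : hom X Y)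
  (t : hom2 f' f'') (s : hom2 f f') :
  id2 g ∘₂ (t ⋅ s) = (id2 g ∘₂ t) ⋅ (id2 g ∘₂ s).
Proof. by rewrite -hcompV vcomp1s. Qed.

Lemma hcomp_idr (X Y Z : obj C) (g : hom X Y) (f f' f'' : hom Y Z)
  (t : hom2 f' f'') (s : hom2 f f') :
  (t ⋅ s) ∘₂ id2 g = (t ∘₂ id2 g) ⋅ (s ∘₂ id2 g).
Proof. by rewrite -hcompV vcomp1s. Qed.

Lemma tens2_idl (X Y X' Y' : obj C) (g : hom X Y) (f f' f'' : hom X' Y')
  (t : hom2 f' f'') (s : hom2 f f') :
  id2 g ⊗₂ (t ⋅ s) = (id2 g ⊗₂ t) ⋅ (id2 g ⊗₂ s).
Proof. by rewrite -tens2V vcomp1s. Qed.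

Lemma tens2_idr (X Y X' Y' : obj C) (g : hom X Y) (f f' f'' : hom X' Y')
  (t : hom2 f' f'') (s : hom2 f f') :
  (t ⋅ s) ⊗₂ id2 g = (t ⊗₂ id2 g) ⋅ (s ⊗₂ id2 g).
Proof. by rewrite -tens2V vcomp1s. Qed.

(** Induction on the number of columns. Naturality of [that] moves the inner [Theta_pair] of the
    later columns outwards; what remains is [that_assoc] for the first column against the tensor of
    the others, and the induction hypothesis. *)
Lemma Theta_pair_assoc n (W X Y Z : fin n.+1 -> obj C)
    (h : forall k, hom (Y k) (Z k)) (g : forall k, hom (X k) (Y k))
    (f : forall k, hom (W k) (X k)) :
  Cell (Theta_pair h (fun k => g k ∘ f k) ⋅ (id2 (bigtens h) ∘₂ Theta_pair g f))
    =
  Cell (Theta_pair (fun k => h k ∘ g k) f ⋅ (Theta_pair h g ∘₂ id2 (bigtens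
    f))).
Proof.
elim: n W X Y Z h g f => [|n IHn] W X Y Z h g f.
  transitivity (Cell (id2 (h None ∘ (g None ∘ f None)) ⋅
    (id2 (h None) ∘₂ id2 (g None ∘ f None)))).
    by [].
  transitivity (Cell (id2 ((h None ∘ g None) ∘ f None) ⋅
    (id2 (h None ∘ g None) ∘₂ id2 (f None)))).
    by rewrite !hcomp11 !vcomp1s; apply: Cell_id2; rewrite /Arr compA.
  by [].
rewrite !Theta_pairS hcomp_idl hcomp_idr -!vcompA /= -!tens2_11.
rewrite (vcompA (that _ _ _ _) (_ ∘₂ _)) that_natural.
rewrite [in RHS](vcompA (that _ _ _ _) (_ ∘₂ _)) that_natural.
rewrite !tens2_11 !hcomp11 -!vcompA !vcompA -!tens2_idl -!vcompA.
apply: Cell_vcomp; last exact: that_assoc.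
by apply: Cell_tens2; [apply: Cell_id2; rewrite /Arr compA | exact: IHn].
Qed.

(** The transposed statement, by induction on the number of rows: naturality of [that] leaves
    [that_tens] for the first row against the composite of the others. *)
Lemma Theta2_assoc m (X Y Z : fin m.+2 -> obj C) (f : chain X) (g : chain Y)
    (h : chain Z) :
  Cell ((id2 (bigcomp f) ⊗₂ Theta2 g h) ⋅ Theta2 f (chain_tens g h)) =
  Cell ((Theta2 f g ⊗₂ id2 (bigcomp h)) ⋅ Theta2 (chain_tens f g) h).
Proof.
elim: m X Y Z f g h => [|m IHm] X Y Z f g h.
  by rewrite /= !tens2_11 !vcomp1s -!tens2_11; exact: tens2A.
rewrite /= !tens2_idl !tens2_idr.
rewrite -!vcompA (vcompA _ (that _ _ _ _)) [in RHS](vcompA _ (that _ _ _ _)).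
rewrite -[id2 (f None ∘ _)]hcomp11 -[id2 (h None ∘ _)]hcomp11.
rewrite -(that_natural (id2 (f None)) (id2 (g None ⊗ h None))).
rewrite -(that_natural (id2 (f None ⊗ g None)) (id2 (h None))).
rewrite !tens2_11 !hcomp11 -!vcompA -!hcomp_idl !vcompA.
apply: Cell_vcomp; first exact: esym (that_tens _ _ _ _ _ _).
by apply: Cell_hcomp; [rewrite -!tens2_11; exact: tens2A | exact: IHm].
Qed.

Lemma Arr_src (X Y X' Y' : obj C) (f : hom X Y) (f' : hom X' Y') :
  Arr f = Arr f' -> X = X'.
Proof. exact: (f_equal (@asrc K C)). Qed.

Lemma Arr_tgt (X Y X' Y' : obj C) (f : hom X Y) (f' : hom X' Y') :
  Arr f = Arr f' -> Y = Y'.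
Proof. exact: (f_equal (@atgt K C)). Qed.

(** The arrows determine the objects: X at [Some j] is the source of the j-th arrow and X at [None]
    the target of the first. As T does not depend on the chain, no transport appears; F is meant to
    be an [oc] of something. *)
Lemma chain_ext m (X X' : fin m.+2 -> obj C) (f : chain X) (f' : chain X')
    T (F : forall X : fin m.+2 -> obj C, chain X -> T) :
  (forall j, Arr (f j) = Arr (f' j)) -> F X f = F X' f'.
Proof.
move=> E; have eX : X = X'.
  by apply: funext => -[j|]; [exact: Arr_src (E j) | exact: Arr_tgt (E None)].
subst X'; congr F; apply: functional_extensionality_dep => j.
exact: Arr_inj (E j).
Qed.

Lemma grid_ext m n (X X' : fin m.+2 -> fin n.+1 -> obj C) (f : grid X)
    (f' : grid X') T (F : forall X : fin m.+2 -> fin n.+1 -> obj C,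
      grid X -> T) :
  (forall j k, Arr (f j k) = Arr (f' j k)) -> F X f = F X' f'.
Proof.
move=> E; have eX : X = X'.
  apply: funext => -[j|]; apply: funext => k; first exact: Arr_src (E j k).
  exact: Arr_tgt (E None k).
subst X'; congr F; apply: functional_extensionality_dep => j.
apply: functional_extensionality_dep => k; exact: Arr_inj (E j k).
Qed.

Lemma Theta2_ext m (X Y X' Y' : fin m.+2 -> obj C) (f : chain X) (g : chain Y)
    (f' : chain X') (g' : chain Y') :
  (forall j, Arr (f j) = Arr (f' j)) -> (forall j, Arr (g j) = Arr (g' j)) ->
  oc (Theta2 f g) = oc (Theta2 f' g').
Proof.
move=> Ef Eg; rewrite (chain_ext (fun Z h => oc (Theta2 h g)) Ef).
exact: (chain_ext (fun Z h => oc (Theta2 f' h)) Eg).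
Qed.

Lemma Theta_pair_ext n (X Y Z X' Y' Z' : fin n.+1 -> obj C)
    (g : forall k, hom (Y k) (Z k)) (f : forall k, hom (X k) (Y k))
    (g' : forall k, hom (Y' k) (Z' k)) (f' : forall k, hom (X' k) (Y' k)) :
  (forall k, Arr (g k) = Arr (g' k)) -> (forall k, Arr (f k) = Arr (f' k)) ->
  oc (Theta_pair g f) = oc (Theta_pair g' f').
Proof.
move=> Eg Ef; rewrite /Theta_pair.
by apply: (grid_ext (f := grid2 g f) (f' := grid2 g' f')
  (fun X h => oc (Theta h))) => -[[[]|]|] k /=.
Qed.

Lemma oc_id2 (X Y X' Y' : obj C) (f : hom X Y) (f' : hom X' Y') :
  Arr f = Arr f' -> oc (id2 f) = oc (id2 f').
Proof. by move=> /Cell_id2 /Cell_oc. Qed.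

Lemma bigtens2_id n (X Y : fin n.+1 -> obj C) (f : forall k, hom (X k) (Y k)) :
  bigtens2 (fun k => id2 (f k)) = id2 (bigtens f).
Proof. by elim: n X Y f => [|n IHn] X Y f //=; rewrite IHn tens2_11. Qed.

Lemma bigcomp2_id m (X : fin m.+2 -> obj C) (f : chain X) :
  bigcomp2 (fun k => id2 (f k)) = id2 (bigcomp f).
Proof. by elim: m X f => [|m IHm] X f //=; rewrite IHm hcomp11. Qed.

Lemma Theta_row n (X : fin 2 -> fin n.+1 -> obj C) (f : grid X) :
  Theta f = id2 (bigtens (f None)).
Proof.
elim: n X f => [|n IHn] X f //=; rewrite vcomps1.
by rewrite -[RHS]tens2_11 -(IHn _ (del_first_col f)).
Qed.

(** [Theta] recurses on columns and [Theta2] on rows, so the induction is on columns; naturality of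
    [that] carries [Theta] of the remaining rows and columns past it. *)
Lemma Theta_first_row m n (X : fin m.+3 -> fin n.+1 -> obj C) (f : grid X) :
  Theta f = Theta_pair (f None) (col_comp (del_first_row f))
            ⋅ (id2 (row_tens f None) ∘₂ Theta (del_first_row f)).
Proof.
elim: n X f => [|n IHn] X f.
  by rewrite /= hcomp11 vcomp1s.
rewrite Theta_pairS /=.
rewrite (IHn _ (del_first_col f)) tens2_idl -!vcompA.
congr (_ ⋅ _); rewrite hcomp_idl !vcompA; congr (_ ⋅ _).
rewrite -[id2 (col_comp f None)]hcomp11.
rewrite -(that_natural (id2 (f None None)) (id2 (row_tens (del_first_col f)
  None))
  (id2 (col_comp (del_first_row f) None)) (Theta (del_first_row (del_first_col
    f)))).
by rewrite tens2_11.
Qed.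

Lemma oc_Theta_first_row m n (X : fin m.+3 -> fin n.+1 -> obj C) (f : grid X) :
  oc (Theta f) =
  vc (oc (Theta_pair (f None) (col_comp (del_first_row f))))
     (hc (oc (id2 (row_tens f None))) (oc (Theta (del_first_row f)))).
Proof. by rewrite Theta_first_row hcE; exact: esym (vcE _ _). Qed.

Lemma oc_Theta_pair_assoc n (W X Y Z : fin n.+1 -> obj C)
    (h : forall k, hom (Y k) (Z k)) (g : forall k, hom (X k) (Y k))
    (f : forall k, hom (W k) (X k)) :
  vc (oc (Theta_pair h (fun k => g k ∘ f k)))
     (hc (oc (id2 (bigtens h))) (oc (Theta_pair g f))) =
  vc (oc (Theta_pair (fun k => h k ∘ g k) f))
     (hc (oc (Theta_pair h g)) (oc (id2 (bigtens f)))).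
Proof. by rewrite !hcE !vcE; apply: Cell_oc; exact: Theta_pair_assoc. Qed.

Lemma hc_idl (X Y : obj C) (g : hom X Y) (x y : ocell C) : vc x y <> None ->
  hc (oc (id2 g)) (vc x y) = vc (hc (oc (id2 g)) x) (hc (oc (id2 g)) y).
Proof. by move=> xy; rewrite -hc_vc // vcE // vcomp1s. Qed.

Lemma hc_idr (X Y : obj C) (g : hom X Y) (x y : ocell C) : vc x y <> None ->
  hc (vc x y) (oc (id2 g)) = vc (hc x (oc (id2 g))) (hc y (oc (id2 g))).
Proof. by move=> xy; rewrite -hc_vc // vcE // vcomp1s. Qed.

Lemma tc_idl (X Y : obj C) (g : hom X Y) (x y : ocell C) : vc x y <> None ->
  tc (oc (id2 g)) (vc x y) = vc (tc (oc (id2 g)) x) (tc (oc (id2 g)) y).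
Proof. by move=> xy; rewrite -tc_vc // vcE // vcomp1s. Qed.

Lemma tc_idr (X Y : obj C) (g : hom X Y) (x y : ocell C) : vc x y <> None ->
  tc (vc x y) (oc (id2 g)) = vc (tc x (oc (id2 g))) (tc y (oc (id2 g))).
Proof. by move=> xy; rewrite -tc_vc // vcE // vcomp1s. Qed.

(** After the first row is split off and the induction hypothesis splits off the last,
    [Theta_pair_assoc] for first row, middle block and last row exchanges the two splittings. *)
Lemma Theta_last_row m n (X : fin m.+3 -> fin n.+1 -> obj C) (f : grid X) :
  oc (Theta f) =
  vc (oc (Theta_pair (col_comp (del_last_row f)) (f (fmax m.+1))))
     (hc (oc (Theta (del_last_row f))) (oc (id2 (row_tens f (fmax m.+1))))).
Proof.
elim: m X f => [|m IHm] X f.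
  rewrite Theta_row hcE hcomp11 vcE vcomps1.
  apply: (grid_ext (f := f) (f' := grid2 _ _) (fun X h => oc (Theta h))).
  by move=> [[[]|]|] k.
(* Definedness comes from the induction hypothesis: this composite is the [oc] of a [Theta], hence
   not [None]. *)
have D : vc (oc (Theta_pair (col_comp (del_last_row (del_first_row f))) (f (fmax
  m.+2))))
   (hc (oc (Theta (del_last_row (del_first_row f)))) (oc (id2 (row_tens f (fmax
     m.+2))))) <> None.
  by rewrite -(IHm _ (del_first_row f)).
rewrite oc_Theta_first_row (IHm _ (del_first_row f)) hc_idl // vcA.
rewrite (oc_Theta_first_row (del_last_row f)).
rewrite hc_idr; last by rewrite -oc_Theta_first_row.
rewrite [RHS]vcA hcA; congr (vc _ _).
rewrite -[RHS]oc_Theta_pair_assoc; congr (vc _ _).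
apply: Theta_pair_ext => // k.
exact: esym (Arr_bigcomp_last (col (del_first_row f) k)).
Qed.
End Coherence.

(** * Factorizations of Theta through merged rows, merged columns and the last column *)

Section MergeCoherence.
Variables (K : pzRingType) (C : linear_gray_semigroup K).

Lemma hc_swap (X Y X' Y' : obj C) (f f' : hom X Y) (g g' : hom X' Y')
    (s : hom2 f f') (t : hom2 g g') :
  vc (hc (oc (id2 f')) (oc t)) (hc (oc s) (oc (id2 g))) =
  vc (hc (oc s) (oc (id2 g'))) (hc (oc (id2 f)) (oc t)).
Proof. by rewrite -!hc_vc ?vcE // !vcomp1s !vcomps1. Qed.

Lemma tc_swap (X Y X' Y' : obj C) (f f' : hom X Y) (g g' : hom X' Y')
    (s : hom2 f f') (t : hom2 g g') :
  vc (tc (oc (id2 f')) (oc t)) (tc (oc s) (oc (id2 g))) =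
  vc (tc (oc s) (oc (id2 g'))) (tc (oc (id2 f)) (oc t)).
Proof. by rewrite -!tc_vc ?vcE // !vcomp1s !vcomps1. Qed.

(** A merge beyond the first row reduces to fewer rows by [oc_Theta_first_row]. For the first two
    rows, interchange slides their [Theta_pair] past [Theta] of the remaining rows, and
    [Theta_pair_assoc] concludes. *)
Lemma Theta_hmerge m n (i : fin m.+1) (X : fin m.+3 -> fin n.+1 -> obj C)
    (f : grid X) :
  oc (Theta f) = vc (oc (Theta (grid_hmerge i f))) (oc (bigcomp2 (hmerge_Theta i
    f))).
Proof.
elim: m i X f => [|m IHm] [i|] X f //.
- rewrite Theta_row vcE vcomp1s.
  apply: (grid_ext (f := f) (f' := grid2 _ _) (fun X h => oc (Theta h))).
  by move=> [[[]|]|] k.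
- have E : oc (bigcomp2 (hmerge_Theta (m := m.+1) (Some i) f)) =
    hc (oc (id2 (row_tens f None)))
       (oc (bigcomp2 (hmerge_Theta i (del_first_row f)))).
    by rewrite hcE.
  have D := IHm i _ (del_first_row f).
  rewrite oc_Theta_first_row D E [in RHS]oc_Theta_first_row -[in RHS]vcA.
  rewrite -[in RHS]hc_idl; last by rewrite -D.
  congr (vc _ _); apply: Theta_pair_ext => // k.
  by apply: esym; apply: (Arr_hmerge i (col (del_first_row f) k)).
- have E : oc (bigcomp2 (hmerge_Theta (m := m.+1) None f)) =
    hc (oc (Theta_pair (f None) (f (Some None))))
       (oc (id2 (gdom (del_first_row (del_first_row f))))).
    by rewrite -[in RHS]bigcomp2_id hcE.
  rewrite E [in RHS]oc_Theta_first_row -[in RHS]vcA.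
  rewrite (hc_swap (Theta_pair (f None) (f (Some None))) (Theta (del_first_row
    (del_first_row f)))).
  rewrite oc_Theta_first_row (oc_Theta_first_row (del_first_row f)).
  rewrite [in LHS]hc_idl; last by rewrite -oc_Theta_first_row.
  rewrite !vcA hcA [hc (oc (id2 _)) (oc (id2 _))]hcE hcomp11.
  by congr (vc _ _); exact: oc_Theta_pair_assoc.
Qed.

Lemma oc_Theta2_assoc m (X Y Z : fin m.+2 -> obj C) (f : chain X) (g : chain Y)
    (h : chain Z) :
  vc (tc (oc (id2 (bigcomp f))) (oc (Theta2 g h))) (oc (Theta2 f (chain_tens g
    h))) =
  vc (tc (oc (Theta2 f g)) (oc (id2 (bigcomp h)))) (oc (Theta2 (chain_tens f g)
    h)).
Proof. by rewrite !tcE !vcE; apply: Cell_oc; exact: Theta2_assoc. Qed.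

Lemma oc_ThetaS m n (X : fin m.+2 -> fin n.+2 -> obj C) (f : grid X) :
  oc (Theta f) = vc (tc (oc (id2 (col_comp f None))) (oc (Theta (del_first_col
    f))))
    (oc (Theta2 (col f None) (row_tens (del_first_col f)))).
Proof. by rewrite tcE; exact: esym (vcE _ _). Qed.

Lemma Theta_last_col m n (X : fin m.+2 -> fin n.+2 -> obj C) (f : grid X) :
  oc (Theta f) =
  vc (tc (oc (Theta (del_last_col f))) (oc (id2 (col_comp f (fmax n.+1)))))
     (oc (Theta2 (row_tens (del_last_col f)) (col f (fmax n.+1)))).
Proof.
elim: n X f => [|n IHn] X f.
  rewrite Theta_2E tcE tens2_11; symmetry; rewrite vcE vcomp1s; reflexivity.
rewrite oc_ThetaS (IHn _ (del_first_col f)) (oc_ThetaS (del_last_col f)).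
rewrite tc_idl; last by rewrite -(IHn _ (del_first_col f)).
rewrite tc_idr; last by rewrite -oc_ThetaS.
rewrite -[in RHS]vcA -[in RHS]tcA -[LHS]vcA; congr (vc _ _).
rewrite -[RHS]oc_Theta2_assoc; congr (vc _ _).
apply: Theta2_ext => // j.
exact: esym (Arr_bigtens_last (del_first_col f j)).
Qed.

(** Same argument in the other direction, with [tc_swap] and [Theta2_assoc]. The merging cells now
    stand on the codomain side of [Theta], whereas in [Theta_hmerge] they stand on the domain
    side. *)
Lemma Theta_vmerge m n (i : fin n.+1) (X : fin m.+2 -> fin n.+2 -> obj C)
    (f : grid X) :
  oc (Theta f) = vc (oc (bigtens2 (vmerge_Theta i f))) (oc (Theta (grid_vmerge i
    f))).
Proof.
elim: n i X f => [|n IHn] [i|] X f //.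
- rewrite Theta_2E; symmetry; exact: etrans (vcE _ _) (congr1 _ (vcomps1 _)).
- have E : oc (bigtens2 (vmerge_Theta (n := n.+1) (Some i) f)) =
    tc (oc (id2 (col_comp f None)))
       (oc (bigtens2 (vmerge_Theta i (del_first_col f)))) by [].
  have D := IHn i _ (del_first_col f).
  rewrite oc_ThetaS D E [in RHS]oc_ThetaS vcA -[in RHS]tc_idl;
    last by rewrite -D.
  congr (vc _ _); apply: Theta2_ext => // j.
  by apply: esym; apply: (Arr_vmerge i (del_first_col f j)).
- have E : oc (bigtens2 (vmerge_Theta (n := n.+1) None f)) =
    tc (oc (Theta2 (col f None) (col f (Some None))))
       (oc (id2 (gcod (del_first_col (del_first_col f))))).
    by rewrite -bigtens2_id.
  rewrite E [in RHS]oc_ThetaS vcA.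
  rewrite -(tc_swap (Theta2 (col f None) (col f (Some None))) (Theta
    (del_first_col (del_first_col f)))).
  rewrite oc_ThetaS (oc_ThetaS (del_first_col f)).
  rewrite [in LHS]tc_idl; last by rewrite -oc_ThetaS.
  rewrite -!vcA tcA [tc (oc (id2 _)) (oc (id2 _))]tcE tens2_11.
  by congr (vc _ _); exact: oc_Theta2_assoc.
Qed.
End MergeCoherence.

(** * Cofaces of normalized cochains *)

Section NormalizedCochains.
Variables (K : comPzRingType) (C : linear_gray_semigroup K).

Lemma psi_ex m n (phi : family C m n) X (f : grid X) :
  exists e, e ⋅ Theta f = phi X f.
Proof.
have [t [ts st]] := is_iso_Theta f.
by exists (phi X f ⋅ t); rewrite -vcompA ts vcomps1.
Qed.

(* [phi] with the canonical isomorphism [Theta] divided out, an endomorphism of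
   [gcod f]. *)
Definition psi m n (phi : family C m n) X (f : grid X) : hom2 (gcod f) (gcod f)
  :=
  projT1 (cid (psi_ex phi f)).

Lemma psiE m n (phi : family C m n) X (f : grid X) :
  psi phi f ⋅ Theta f = phi X f.
Proof. by rewrite /psi; case: cid. Qed.

Lemma oc_psi m n (phi : family C m n) X (f : grid X) :
  oc (phi X f) = vc (oc (psi phi f)) (oc (Theta f)).
Proof. by rewrite vcE psiE. Qed.

Lemma psi_ext m n (phi : family C m n) X (f : grid X) X' (f' : grid X') :
  (forall j k, Arr (f j k) = Arr (f' j k)) -> oc (psi phi f) = oc (psi phi f').
Proof. exact: (grid_ext (fun X f => oc (psi phi f))). Qed.

Lemma eq_psi m n (phi phi' : family C m n) X (f : grid X) :
  oc (psi phi f) = oc (psi phi' f) -> phi X f = phi' X f.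
Proof. by move=> E; rewrite -psiE (oc_inj E) psiE. Qed.

(** As t and s are invertible, so is r in t = s ⋅ r, and r can be cancelled from e ⋅ s ⋅ r = s ⋅ u ⋅
    r. With t a [Theta], this turns a formula for a coface into a conjugation. *)
Lemma conj_factor (W Z X Y : obj C) (a b : hom W Z) (e : hom2 b b) (t : hom2 a
  b)
    (g h : hom X Y) (s : hom2 g h) (u : hom2 g g) (r : ocell C) :
  is_iso t -> is_iso s -> oc t = vc (oc s) r ->
  vc (oc e) (oc t) = vc (oc s) (vc (oc u) r) ->
  conjugates (oc s) (oc u) (oc e).
Proof.
move=> ti si Et; have /vcP : vc (oc s) r <> None by rewrite -Et.
move=> [X' [Y' [f' [g' [h' [s' [r' [/oc_Cell Es Er E2]]]]]]]].
have eX := Cell_src Es; have eY := Cell_tgt Es; subst X' Y'.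
have eg := Arr_inj (Cell_dom Es); have eh := Arr_inj (Cell_cod Es);
  subst g' h' r.
move: Et; rewrite vcE => /oc_Cell Et.
have eX := Cell_src Et; have eY := Cell_tgt Et; subst W Z.
have ea := Arr_inj (Cell_dom Et); have eb := Arr_inj (Cell_cod Et); subst a b.
rewrite !vcE => /oc_inj Ee; apply: conjI => //.
have [t' [_ tt']] := ti; have [s1 [s1s ss1]] := si.
(* The cell [s1 ⋅ t] is r itself, in a form that is visibly invertible. *)
apply: oc_inj; apply: (vc_cancel (s := s1 ⋅ t) (t := e ⋅ t)).
- by apply: is_iso_vcomp => //; exists s.
- by rewrite vcE -vcompA (vcompA s) ss1 vcomp1s.
- rewrite vcE Ee (Cell_inj Et) (vcompA s1) s1s vcomp1s.
  by rewrite vcompA.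
Qed.

Lemma psi_conj m n (phi : family C m n) X (f : grid X) (Y Z : obj C)
    (g h : hom Y Z) (s : hom2 g h) (u : hom2 g g) (r : ocell C) :
  is_iso s -> oc (Theta f) = vc (oc s) r ->
  oc (phi X f) = vc (oc s) (vc (oc u) r) ->
  conjugates (oc s) (oc u) (oc (psi phi f)).
Proof.
move=> si Et E; apply: conj_factor si Et _; first exact: is_iso_Theta.
by rewrite -(oc_psi phi).
Qed.

Lemma psi_eq m n (phi : family C m n) X (f : grid X) (Y Z : obj C)
    (g : hom Y Z) (u : hom2 g g) :
  oc (phi X f) = vc (oc u) (oc (Theta f)) -> oc (psi phi f) = oc u.
Proof.
rewrite (oc_psi phi) vcE => E; apply: esym.
apply: (vc_cancel (is_iso_Theta f) (esym E)); by rewrite vcE.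
Qed.

(** Precomposed with [Theta f], both sides become [col_comp2 s ⋅ phi X f], by naturality of [Theta]
    and of phi. *)
Lemma psi_natural m n (phi : family C m n) X (f g : grid X)
    (s : forall j k, hom2 (f j k) (g j k)) :
  natural phi -> is_iso (col_comp2 s) ->
  conjugates (oc (col_comp2 s)) (oc (psi phi f)) (oc (psi phi g)).
Proof.
move=> nphi si; apply: conjI => //; apply: oc_inj.
apply: (vc_cancel (s := Theta f) (t := col_comp2 s ⋅ phi X f) (is_iso_Theta f)).
  by rewrite vcE -vcompA -Theta_natural vcompA psiE nphi.
by rewrite vcE -vcompA psiE.
Qed.

Lemma is_iso_Theta_pair n (X Y Z : fin n.+1 -> obj C)
    (g : forall k, hom (Y k) (Z k)) (f : forall k, hom (X k) (Y k)) :
  is_iso (Theta_pair g f).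
Proof. exact: is_iso_Theta (grid2 g f). Qed.

Lemma psi_dh_first m n (phi : family C m n) X (f : @grid K C m.+1 n X) :
  conjugates (oc (Theta_pair (f None) (col_comp (del_first_row f))))
       (hc (oc (id2 (row_tens f None))) (oc (psi phi (del_first_row f))))
       (oc (psi (dh_first phi) f)).
Proof.
rewrite hcE; apply: psi_conj; first exact: is_iso_Theta_pair.
  exact: oc_Theta_first_row.
rewrite -hcE -hc_idl; last by rewrite -(oc_psi phi).
by rewrite -(oc_psi phi) hcE; exact: esym (vcE _ _).
Qed.

Lemma psi_dh_last m n (phi : family C m n) X (f : @grid K C m.+1 n X) :
  conjugates (oc (Theta_pair (col_comp (del_last_row f)) (f (fmax m.+1))))
       (hc (oc (psi phi (del_last_row f))) (oc (id2 (row_tens f (fmax m.+1)))))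
       (oc (psi (dh_last phi) f)).
Proof.
rewrite hcE; apply: psi_conj; first exact: is_iso_Theta_pair.
  exact: Theta_last_row.
rewrite -hcE -hc_idr; last by rewrite -(oc_psi phi).
rewrite -(oc_psi phi) hcE; rewrite (Cell_oc (Cell_cast (dh_last_par f) _)).
exact: esym (vcE _ _).
Qed.

(** The cells [hmerge_Theta] act on the domain, which dividing by [Theta] forgets, so nothing is
    conjugated. In [psi_dv_inner] the merging cells act on the codomain and do conjugate. *)
Lemma psi_dh_inner m n (phi : family C m n) i X (f : @grid K C m.+1 n X) :
  oc (psi (fun X f => dh_inner phi i f) f) = oc (psi phi (grid_hmerge i f)).
Proof.
apply: psi_eq; rewrite (Cell_oc (Cell_cast (dh_inner_par i f) _)).
by rewrite (Theta_hmerge i) vcA -(oc_psi phi); exact: esym (vcE _ _).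
Qed.

Lemma psi_dv_first m n (phi : family C m n) X (f : @grid K C m n.+1 X) :
  oc (psi (dv_first phi) f) =
  tc (oc (id2 (col_comp f None))) (oc (psi phi (del_first_col f))).
Proof.
apply: psi_eq; rewrite -[oc (_ ⊗₂ _)]tcE oc_ThetaS vcA -tc_idl.
  by rewrite -(oc_psi phi); exact: esym (vcE _ _).
by rewrite -(oc_psi phi).
Qed.

Lemma psi_dv_last m n (phi : family C m n) X (f : @grid K C m n.+1 X) :
  oc (psi (dv_last phi) f) =
  tc (oc (psi phi (del_last_col f))) (oc (id2 (col_comp f (fmax n.+1)))).
Proof.
apply: psi_eq; rewrite (Cell_oc (Cell_cast (dv_last_par f) _)).
rewrite -[oc (_ ⊗₂ _)]tcE Theta_last_col vcA -tc_idr.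
  by rewrite -(oc_psi phi); exact: esym (vcE _ _).
by rewrite -(oc_psi phi).
Qed.

Lemma is_iso_bigtens2 n (X Y : fin n.+1 -> obj C) (f g : forall k,
  hom (X k) (Y k))
  (s : forall k, hom2 (f k) (g k)) : (forall k,
    is_iso (s k)) -> is_iso (bigtens2 s).
Proof.
elim: n X Y f g s => [|n IHn] X Y f g s si /=; first exact: si.
by apply: is_iso_tens2; [exact: si | exact: IHn].
Qed.

Lemma is_iso_vmerge_Theta m n (i : fin n.+1) (X : fin m.+2 -> fin n.+2 -> obj C)
  (f : grid X) k : is_iso (vmerge_Theta i f k).
Proof.
elim: n i X f k => [|n IHn] [i|] X f k //; first exact: is_iso_Theta2.
  case: k => [k|]; [exact: (IHn i _ (del_first_col f)) | exact: is_iso_id].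
by case: k => [k|]; [exact: is_iso_id | exact: is_iso_Theta2].
Qed.

Lemma psi_dv_inner m n (phi : family C m n) i X (f : @grid K C m n.+1 X) :
  conjugates (oc (bigtens2 (vmerge_Theta i f))) (oc (psi phi (grid_vmerge i f)))
       (oc (psi (fun X f => dv_inner phi i f) f)).
Proof.
apply: psi_conj.
- apply: is_iso_bigtens2 => k; exact: is_iso_vmerge_Theta.
- exact: Theta_vmerge.
- rewrite (Cell_oc (Cell_cast (dv_inner_par i f) _)) -(oc_psi phi).
  exact: esym (vcE _ _).
Qed.
End NormalizedCochains.

(** * Cosimplicial identities *)

Section HorizontalIdentities.
Variables (K : comPzRingType) (C : linear_gray_semigroup K).

Lemma conj_eq (x x' a a' b b' : ocell C) :
  conjugates x a b -> conjugates x' a' b' -> x = x' -> a = a' -> b = b'.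
Proof. by move=> E E' ex ea; subst x' a'; exact: conj_uniq E E'. Qed.

(** For i = j both sides compose the same three arrows and differ by associativity; for i < j the
    two merges concern different pairs. *)
Lemma hmerge_face m (i j : fin m.+1) (X : fin m.+4 -> obj C) (f : chain X) l :
  (fval i <= fval j)%N ->
  Arr (hmerge j (hmerge (fwiden i) f) l) =
  Arr (hmerge i (hmerge (Some j : fin m.+2) f) l).
Proof.
elim: m i j X f l => [|m IHm] [i|] [j|] X f l //=.
- by case: l => [[]|] _; rewrite /Arr compA.
- case: l => [l|] // lij; exact: (IHm i j _ (fun j => f (Some j))).
- by case: l.
- by case: l => [l|] // _; rewrite /Arr compA.
Qed.

Lemma hmerge_last m (i : fin m.+1) (X : fin m.+4 -> obj C) (f : chain X) :
  Arr (hmerge (fwiden i : fin m.+2) f (fmax m.+1)) = Arr (f (fmax m.+2)).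
Proof.
elim: m i X f => [|m IHm] [i|] X f //.
exact: (IHm i _ (fun j => f (Some j))).
Qed.

Lemma hmerge_init m (i : fin m.+1) (X : fin m.+4 -> obj C) (f : chain X) j :
  Arr (hmerge (fwiden i : fin m.+2) f (fwiden j)) =
  Arr (@hmerge K C m i (fun j => X (fwiden j)) (fun j => f (fwiden j)) j).
Proof.
elim: m i X f j => [|m IHm] [i|] X f [j|] //.
exact: (IHm i _ (fun j => f (Some j))).
Qed.

Lemma hmerge_max_last m (X : fin m.+3 -> obj C) (f : chain X) :
  Arr (hmerge (fmax m) f (fmax m)) = Arr (f (fwiden (fmax m)) ∘ f (fmax m.+1)).
Proof.
by elim: m X f => [|m IHm] X f //; exact: (IHm _ (fun j => f (Some j))).
Qed.

Lemma hmerge_max_init m (X : fin m.+4 -> obj C) (f : chain X) j :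
  Arr (hmerge (fmax m.+1) f (fwiden j)) = Arr (f (fwiden (fwiden j))).
Proof.
elim: m X f j => [|m IHm] X f [j|] //; exact: (IHm _ (fun j => f (Some j))).
Qed.

Section Identities.
Variables (m n : nat) (phi : family C m n).
Variables (X : fin m.+4 -> fin n.+1 -> obj C) (f : @grid K C m.+2 n X).

Lemma dh_inner_inner (i j : fin m.+1) : (fval i <= fval j)%N ->
  dh_inner (fun X f => dh_inner phi i f) (Some j : fin m.+2) f =
  dh_inner (fun X f => dh_inner phi j f) (fwiden i) f.
Proof.
move=> lij; apply: (eq_psi (phi := fun X f => dh_inner _ _ f)
  (phi' := fun X f => dh_inner _ _ f)).
rewrite !psi_dh_inner; apply: psi_ext => l k.
exact: esym (hmerge_face (col f k) l lij).
Qed.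

(** The conjugating cells agree by [Theta_pair_assoc] for the first row, the second row and the
    composite of the others. *)
Lemma dh_inner_first0 :
  dh_inner (dh_first phi) (None : fin m.+2) f = dh_first (dh_first phi) f.
Proof.
apply: (eq_psi (phi := fun X f => dh_inner _ _ f)); rewrite psi_dh_inner.
have A := psi_dh_first phi (grid_hmerge (None : fin m.+2) f).
(* The identity of the merged row is seen as the conjugate, along [Theta_pair], of the identity of
   the two rows composed. Both sides then start from the same cell. *)
have A1 := conj_hc (conj_iso1 (is_iso_Theta_pair (f None) (f (Some None))))
  (conj_id1 (psi phi (del_first_row (del_first_row f)))).
have {A A1} A := conj_vc (A1 _) A.
have B := conj_hc (conj_id1 (id2 (row_tens f None))) (psi_dh_first phi
  (del_first_row f)).
have {}B := conj_vc (B _) (psi_dh_first (dh_first phi) f).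
apply: (conj_eq (A _) (B _)).
- by rewrite hcE.
- by rewrite !hcE.
- exact: esym (oc_Theta_pair_assoc _ _ _).
- by rewrite hcA [hc (oc (id2 _)) (oc (id2 _))]hcE hcomp11.
Qed.

Lemma dh_inner_first (j : fin m.+1) :
  dh_inner (dh_first phi) (Some j : fin m.+2) f =
  dh_first (fun X f => dh_inner phi j f) f.
Proof.
apply: (eq_psi (phi := fun X f => dh_inner _ _ f)); rewrite psi_dh_inner.
have A := psi_dh_first phi (grid_hmerge (Some j : fin m.+2) f).
have B := psi_dh_first (fun X f => dh_inner phi j f) f.
apply: (conj_eq A B).
- apply: Theta_pair_ext => // k. exact (Arr_hmerge j (col (del_first_row f) k)).
- by rewrite psi_dh_inner.
Qed.

(** Both sides conjugate 1 ∘ psi ∘ 1; [Theta_pair_assoc] is applied to the first row, the composed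
    middle rows and the last row. *)
Lemma dh_last_first : dh_last (dh_first phi) f = dh_first (dh_last phi) f.
Proof.
apply: eq_psi.
have A1 := conj_hc (psi_dh_first phi (del_last_row f)) (conj_id1 (id2 (row_tens
  f (fmax m.+2)))).
have {A1} A := conj_vc (A1 _) (psi_dh_last (dh_first phi) f).
have B1 := conj_hc (conj_id1 (id2 (row_tens f None))) (psi_dh_last phi
  (del_first_row f)).
have {B1} B := conj_vc (B1 _) (psi_dh_first (dh_last phi) f).
apply: (conj_eq (A _) (B _)).
- by rewrite !hcE.
- by rewrite !hcE.
- rewrite -[LHS]oc_Theta_pair_assoc; congr (vc _ _).
  apply: Theta_pair_ext => // k; exact: Arr_bigcomp_last (col (del_first_row f)
    k).
- by rewrite hcA.
Qed.

Lemma dh_last_inner (i : fin m.+1) :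
  dh_last (fun X f => dh_inner phi i f) f =
  dh_inner (dh_last phi) (fwiden i : fin m.+2) f.
Proof.
apply: (eq_psi (phi' := fun X f => dh_inner _ _ f)); rewrite psi_dh_inner.
have A := psi_dh_last (fun X f => dh_inner phi i f) f.
have B := psi_dh_last phi (grid_hmerge (fwiden i : fin m.+2) f).
rewrite psi_dh_inner in A.
have last_hm k := hmerge_last i (col f k).
have init_hm k l := hmerge_init i (col f k) l.
apply: (conj_eq A B).
- apply: Theta_pair_ext => k; last exact: (esym (last_hm k)).
  rewrite -(Arr_hmerge i (col (del_last_row f) k)).
  by apply: Arr_bigcomp => l; exact: (esym (init_hm k l)).
- congr (hc _ _); first by apply: psi_ext => l k; exact: (esym (init_hm k l)).
  by apply: oc_id2; apply: Arr_bigtens => k; exact: (esym (last_hm k)).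
Qed.

Lemma dh_last_last :
  dh_last (dh_last phi) f = dh_inner (dh_last phi) (fmax m.+1 : fin m.+2) f.
Proof.
apply: (eq_psi (phi' := fun X f => dh_inner _ _ f)); rewrite psi_dh_inner.
have A1 := conj_hc (psi_dh_last phi (del_last_row f)) (conj_id1 (id2 (row_tens f
  (fmax m.+2)))).
have {A1} A := conj_vc (A1 _) (psi_dh_last (dh_last phi) f).
have B := psi_dh_last phi (grid_hmerge (fmax m.+1 : fin m.+2) f).
have last_hm k := hmerge_max_last (col f k).
have init_hm k l := hmerge_max_init (col f k) l.
(* The pieces of the merged grid are put in explicit form: the untouched rows of f and the composite
   of its last two rows. Only then can the identity of that composite be obtained by conjugation
   along [Theta_pair]. *)
rewrite (@psi_ext _ _ _ _ phi _ _ _ (del_last_row (del_last_row f))) in B;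
  last first.
  by move=> l k; exact: (init_hm k l).
rewrite (@oc_id2 _ _ _ _ _ _ _ (bigtens (fun k => f (fwiden (fmax m.+1)) k ∘ f
  (fmax m.+2) k))) in B; last first.
  by apply: Arr_bigtens => k; exact: (last_hm k).
rewrite (@Theta_pair_ext _ _ _ _ _ _ _ _ _ _ _ (col_comp (del_last_row
  (del_last_row f)))
  (fun k => f (fwiden (fmax m.+1)) k ∘ f (fmax m.+2) k)) in B; first last.
- by move=> k; exact: (last_hm k).
- by move=> k; apply: Arr_bigcomp => l; exact: (init_hm k l).
have B1 := conj_hc (conj_id1 (psi phi (del_last_row (del_last_row f))))
  (conj_iso1 (is_iso_Theta_pair (f (fwiden (fmax m.+1))) (f (fmax m.+2)))).
have {B1} B := conj_vc (B1 _) B.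
apply: (conj_eq (A _) (B _)).
- by rewrite !hcE.
- by rewrite !hcE.
- rewrite [RHS]oc_Theta_pair_assoc; congr (vc _ _).
  apply: Theta_pair_ext => // k. 
  exact: (esym (Arr_bigcomp_last (col (del_last_row f) k))).
- by rewrite -hcA [hc (oc (id2 _)) (oc (id2 _))]hcE hcomp11.
Qed.
End Identities.
End HorizontalIdentities.

(** * Cosimplicial identities in the tensor direction *)

Section VerticalIdentities.
Variables (K : comPzRingType) (C : linear_gray_semigroup K).

Lemma vmerge_face n (i j : fin n.+1) (X Y : fin n.+3 -> obj C)
    (f : forall k, hom (X k) (Y k)) k :
  (fval i <= fval j)%N ->
  Arr (vmerge j (vmerge (fwiden i) f) k) =
  Arr (vmerge i (vmerge (Some j : fin n.+2) f) k).
Proof.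
elim: n i j X Y f k => [|n IHn] [i|] [j|] X Y f k //=.
- by move=> _; exact: (esym (tensA _ _ _)).
- case: k => [k|] // lij; exact: (IHn i j _ _ (fun j => f (Some j))).
- by case: k => [k|] // _; exact: (esym (tensA _ _ _)).
Qed.

Lemma vmerge_last n (i : fin n.+1) (X Y : fin n.+3 -> obj C)
    (f : forall k, hom (X k) (Y k)) :
  Arr (vmerge (fwiden i : fin n.+2) f (fmax n.+1)) = Arr (f (fmax n.+2)).
Proof.
elim: n i X Y f => [|n IHn] [i|] X Y f //.
exact: (IHn i _ _ (fun j => f (Some j))).
Qed.

Lemma vmerge_init n (i : fin n.+1) (X Y : fin n.+3 -> obj C)
    (f : forall k, hom (X k) (Y k)) k :
  Arr (vmerge (fwiden i : fin n.+2) f (fwiden k)) =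
  Arr (@vmerge K C n i (fun k => X (fwiden k)) (fun k => Y (fwiden k))
         (fun k => f (fwiden k)) k).
Proof.
elim: n i X Y f k => [|n IHn] [i|] X Y f [k|] //.
exact: (IHn i _ _ (fun j => f (Some j))).
Qed.

Lemma vmerge_max_init n (X Y : fin n.+3 -> obj C)
    (f : forall k, hom (X k) (Y k)) k :
  Arr (vmerge (fmax n.+1) f (fwiden k)) = Arr (f (fwiden (fwiden k))).
Proof.
elim: n X Y f k => [|n IHn] X Y f [k|] //.
exact: (IHn _ _ (fun j => f (Some j))).
Qed.

Lemma vmerge_max_last n (X Y : fin n.+2 -> obj C)
    (f : forall k, hom (X k) (Y k)) :
  Arr (vmerge (fmax n) f (fmax n)) = Arr (f (fwiden (fmax n)) ⊗ f (fmax n.+1)).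
Proof.
elim: n X Y f => [|n IHn] X Y f //; exact: (IHn _ _ (fun j => f (Some j))).
Qed.

Lemma vmerge_Theta_last m n (i : fin n.+1) X (f : @grid K C m n.+2 X) :
  oc (vmerge_Theta (fwiden i : fin n.+2) f (fmax n.+1)) =
  oc (id2 (col_comp f (fmax n.+2))).
Proof.
elim: n i X f => [|n IHn] [i|] X f //.
exact: (IHn i _ (del_first_col f)).
Qed.

Lemma vmerge_Theta_init m n (i : fin n.+1) X (f : @grid K C m n.+2 X) k :
  oc (vmerge_Theta (fwiden i : fin n.+2) f (fwiden k)) =
  oc (vmerge_Theta i (del_last_col f) k).
Proof.
elim: n i X f k => [|n IHn] [i|] X f [k|] //.
exact: (IHn i _ (del_first_col f)).
Qed.

Lemma vmerge_Theta_max_init m n X (f : @grid K C m n.+2 X) k :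
  oc (vmerge_Theta (fmax n.+1) f (fwiden k)) =
  oc (id2 (col_comp f (fwiden (fwiden k)))).
Proof.
elim: n X f k => [|n IHn] X f [k|] //.
exact: (IHn _ (del_first_col f)).
Qed.

Lemma vmerge_Theta_max_last m n X (f : @grid K C m n.+1 X) :
  oc (vmerge_Theta (fmax n) f (fmax n)) =
  oc (Theta2 (col f (fwiden (fmax n))) (col f (fmax n.+1))).
Proof.
elim: n X f => [|n IHn] X f //; exact: (IHn _ (del_first_col f)).
Qed.

Lemma oc_bigtens2_last n (X Y : fin n.+2 -> obj C)
    (f g : forall k, hom (X k) (Y k)) (s : forall k, hom2 (f k) (g k)) :
  oc (bigtens2 s) = tc (oc (@bigtens2 K C n (fun k => X (fwiden k)) (fun k => Y
    (fwiden k))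
          (fun k => f (fwiden k)) (fun k => g (fwiden k))
          (fun k => s (fwiden k)))) (oc (s (fmax n.+1))).
Proof. by rewrite tcE; apply: Cell_oc; exact: esym (Cell_bigtens2_last s). Qed.

Lemma oc_bigtens2 n (X Y X' Y' : fin n.+1 -> obj C)
    (f g : forall k, hom (X k) (Y k)) (f' g' : forall k, hom (X' k) (Y' k))
    (s : forall k, hom2 (f k) (g k)) (s' : forall k, hom2 (f' k) (g' k)) :
  (forall k, oc (s k) = oc (s' k)) -> oc (bigtens2 s) = oc (bigtens2 s').
Proof.
by move=> E; apply: Cell_oc; apply: Cell_bigtens2 => k; exact: oc_Cell (E k).
Qed.

Lemma bigtens2_vmerge_widen m n (i : fin n.+1) X (f : @grid K C m n.+2 X) :
  oc (bigtens2 (vmerge_Theta (fwiden i : fin n.+2) f)) =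
  tc (oc (bigtens2 (vmerge_Theta i (del_last_col f)))) (oc (id2 (col_comp f
    (fmax n.+2)))).
Proof.
rewrite oc_bigtens2_last vmerge_Theta_last; congr (tc _ _).
by apply: oc_bigtens2 => k; exact: vmerge_Theta_init.
Qed.

Lemma bigtens2_vmerge_max m n X (f : @grid K C m n.+2 X) :
  oc (bigtens2 (vmerge_Theta (fmax n.+1) f)) =
  tc (oc (id2 (gcod (del_last_col (del_last_col f)))))
     (oc (Theta2 (col f (fwiden (fmax n.+1))) (col f (fmax n.+2)))).
Proof.
rewrite oc_bigtens2_last vmerge_Theta_max_last -bigtens2_id; congr (tc _ _).
by apply: oc_bigtens2 => k; exact: vmerge_Theta_max_init.
Qed.

Lemma bigtens2_vmerge0 m n X (f : @grid K C m n.+2 X) :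
  oc (bigtens2 (vmerge_Theta (None : fin n.+2) f)) =
  tc (oc (Theta2 (col f None) (col f (Some None))))
     (oc (id2 (gcod (del_first_col (del_first_col f))))).
Proof. by rewrite -bigtens2_id. Qed.

Lemma bigtens2_vmergeS m n (i : fin n.+1) X (f : @grid K C m n.+2 X) :
  oc (bigtens2 (vmerge_Theta (Some i : fin n.+2) f)) =
  tc (oc (id2 (col_comp f None))) (oc (bigtens2 (vmerge_Theta i (del_first_col
    f)))).
Proof. by []. Qed.

Section Identities.
Variables (m n : nat) (phi : family C m n).
Variables (X : fin m.+2 -> fin n.+3 -> obj C) (f : @grid K C m n.+2 X).

(** Both double merges lead to the same grid, and each pair of merging cells composed with [Theta]
    of that grid gives [Theta f]. Cancelling this invertible [Theta] identifies the conjugating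
    cells. *)
Lemma dv_inner_inner (i j : fin n.+1) : (fval i <= fval j)%N ->
  dv_inner (fun X f => dv_inner phi i f) (Some j : fin n.+2) f =
  dv_inner (fun X f => dv_inner phi j f) (fwiden i) f.
Proof.
move=> lij; apply: (eq_psi (phi := fun X f => dv_inner _ _ f)
  (phi' := fun X f => dv_inner _ _ f)).
have A := conj_vc (psi_dv_inner phi i (grid_vmerge (Some j : fin n.+2) f))
  (psi_dv_inner (fun X f => dv_inner phi i f) (Some j : fin n.+2) f).
have B := conj_vc (psi_dv_inner phi j (grid_vmerge (fwiden i : fin n.+2) f))
  (psi_dv_inner (fun X f => dv_inner phi j f) (fwiden i : fin n.+2) f).
have Ev l k := vmerge_face (f l) k lij.
apply: (conj_eq A B); last by apply: psi_ext => l k; exact: (esym (Ev l k)).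
apply: (vc_cancel (t := Theta f) (is_iso_Theta (grid_vmerge i (grid_vmerge (Some
  j : fin n.+2) f)))).
  by rewrite -vcA -!Theta_vmerge.
rewrite (grid_ext (f' := grid_vmerge j (grid_vmerge (fwiden i : fin n.+2) f))
  (fun X f => oc (Theta f))).
  by rewrite -vcA -!Theta_vmerge.
by move=> l k; exact: (esym (Ev l k)).
Qed.

(** Conjugation by [Theta2] of the first two columns takes an identity to an identity, so only
    associativity of the tensor product is left. *)
Lemma dv_inner_first0 :
  dv_inner (dv_first phi) (None : fin n.+2) f = dv_first (dv_first phi) f.
Proof.
apply: (eq_psi (phi := fun X f => dv_inner _ _ f)); rewrite !psi_dv_first.
have A := psi_dv_inner (dv_first phi) (None : fin n.+2) f.
rewrite psi_dv_first bigtens2_vmerge0 in A.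
have B := conj_tc (conj_iso1 (is_iso_Theta2 (col f None) (col f (Some None))))
  (conj_id1 (psi phi (del_first_col (del_first_col f)))).
by rewrite (conj_uniq A B) tcA [tc (oc (id2 _)) (oc (id2 _))]tcE tens2_11.
Qed.

Lemma dv_inner_first (j : fin n.+1) :
  dv_inner (dv_first phi) (Some j : fin n.+2) f =
  dv_first (fun X f => dv_inner phi j f) f.
Proof.
apply: (eq_psi (phi := fun X f => dv_inner _ _ f)); rewrite !psi_dv_first.
have A := psi_dv_inner (dv_first phi) (Some j : fin n.+2) f.
rewrite psi_dv_first bigtens2_vmergeS in A.
exact: conj_uniq A (conj_tc (conj_id1 _) (psi_dv_inner phi j (del_first_col
  f))).
Qed.

Lemma dv_last_first : dv_last (dv_first phi) f = dv_first (dv_last phi) f.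
Proof.
by apply: eq_psi; rewrite psi_dv_first !psi_dv_last psi_dv_first tcA.
Qed.

Lemma dv_last_inner (i : fin n.+1) :
  dv_last (fun X f => dv_inner phi i f) f =
  dv_inner (dv_last phi) (fwiden i : fin n.+2) f.
Proof.
apply: (eq_psi (phi' := fun X f => dv_inner _ _ f)); rewrite psi_dv_last.
have A := psi_dv_inner (dv_last phi) (fwiden i : fin n.+2) f.
rewrite psi_dv_last bigtens2_vmerge_widen in A.
apply: conj_eq (conj_tc (psi_dv_inner phi i (del_last_col f)) (conj_id1 _)) A _
  _ => //.
congr (tc _ _).
  by apply: psi_ext => l k; exact: (esym (vmerge_init i (f l) k)).
apply: oc_id2; apply: Arr_bigcomp => l; exact: (esym (vmerge_last i (f l))).
Qed.

Lemma dv_last_last :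
  dv_last (dv_last phi) f = dv_inner (dv_last phi) (fmax n.+1 : fin n.+2) f.
Proof.
apply: (eq_psi (phi' := fun X f => dv_inner _ _ f)); rewrite !psi_dv_last.
have A := psi_dv_inner (dv_last phi) (fmax n.+1) f.
rewrite psi_dv_last bigtens2_vmerge_max in A.
have B := conj_tc (conj_id1 (psi phi (del_last_col (del_last_col f))))
  (conj_iso1 (is_iso_Theta2 (col f (fwiden (fmax n.+1))) (col f (fmax n.+2)))).
rewrite -tcA [tc (oc (id2 _)) (oc (id2 _))]tcE tens2_11.
apply: conj_eq B A _ _ => //; congr (tc _ _).
  by apply: psi_ext => l k; exact: (esym (vmerge_max_init (f l) k)).
by apply: oc_id2; apply: Arr_bigcomp => l; exact: (esym (vmerge_max_last (f
  l))).
Qed.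
End Identities.
End VerticalIdentities.

(** * Commutation of horizontal with vertical cofaces *)

Section MixedIdentities.
Variables (K : comPzRingType) (C : linear_gray_semigroup K).

(* The naturality cells that compare merging columns first with merging rows
   first; they are identities except in the merged row. *)
Fixpoint swap_cell m n (j : fin n.+1) : forall (i : fin m.+1) X
    (f : @grid K C m.+1 n.+1 X) (l : fin m.+1) (k : fin n.+1),
    hom2 (grid_hmerge i (grid_vmerge j f) l k)
         (grid_vmerge j (grid_hmerge i f) l k) :=
  match m with
  | 0 => fun i =>
      match i with
      | None => fun X f l k =>
          match l with
          | None => vmerge_Theta j (grid2 (f None) (f (Some None))) k
          | Some v => match v with end
          end
      | Some v => match v with end
      end
  | p.+1 => fun i =>
      match i with
      | None => fun X f l k =>
          match l with
          | None => vmerge_Theta j (grid2 (f None) (f (Some None))) k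
          | Some l' => id2 (vmerge j (f (Some (Some l'))) k)
          end
      | Some i' => fun X f l k =>
          match l with
          | None => id2 (vmerge j (f None) k)
          | Some l' => @swap_cell p n j i' _ (del_first_row f) l' k
          end
      end
  end.

Lemma is_iso_swap_cell m n (i : fin m.+1) (j : fin n.+1) X
    (f : @grid K C m.+1 n.+1 X) l k : is_iso (swap_cell j i f l k).
Proof.
elim: m i X f l => [|m IHm] [i|] X f [l|] //=; try exact: is_iso_id;
  try exact: (is_iso_vmerge_Theta j (grid2 (f None) (f (Some None))) k).
exact: (IHm i _ (del_first_row f)).
Qed.

(** In the merged row this is [Theta_vmerge] for a grid of two rows; in the other rows all cells are
    identities. *)
Lemma swap_cell_hmerge m n (i : fin m.+1) (j : fin n.+1) X
    (f : @grid K C m.+1 n.+1 X) l :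
  vc (oc (bigtens2 (swap_cell j i f l))) (oc (hmerge_Theta i (grid_vmerge j f)
    l)) =
  oc (hmerge_Theta i f l).
Proof.
have Epair (U V W : fin n.+2 -> obj C) (a : forall k,
  hom (V k) (W k)) (b : forall k, hom (U k) (V k)) :
  vc (oc (bigtens2 (vmerge_Theta j (grid2 a b)))) (oc (Theta_pair (vmerge j a)
    (vmerge j b))) = oc (Theta_pair a b).
  rewrite [RHS](Theta_vmerge j (grid2 a b)); congr (vc _ _).
  apply: (grid_ext (f := grid2 _ _) (fun X f => oc (Theta f))).
  by move=> [[[]|]|] k.
have idl (U V : fin n.+2 -> obj C) (a : forall k, hom (U k) (V k)) :
  vc (oc (bigtens2 (fun k => id2 (vmerge j a k)))) (oc (id2 (bigtens (vmerge j
    a)))) = oc (id2 (bigtens a)).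
  by rewrite bigtens2_id vcE vcomp1s; apply: oc_id2; exact: Arr_vmerge.
elim: m i X f l => [|m IHm] [i|] X f [l|] //=; try exact: Epair; try exact: idl.
exact: (IHm i _ (del_first_row f)).
Qed.

Lemma is_iso_bigcomp2 m (X : fin m.+2 -> obj C) (f g : chain X)
  (s : forall k, hom2 (f k) (g k)) : (forall k,
    is_iso (s k)) -> is_iso (bigcomp2 s).
Proof.
elim: m X f g s => [|m IHm] X f g s si /=; first exact: si.
by apply: is_iso_hcomp; [exact: si | apply: IHm => k; exact: si].
Qed.

Lemma oc_bigcomp2 m (X X' : fin m.+2 -> obj C) (f g : chain X) (f' g' : chain
  X')
    (s : forall k, hom2 (f k) (g k)) (s' : forall k, hom2 (f' k) (g' k)) :
  (forall k, oc (s k) = oc (s' k)) -> oc (bigcomp2 s) = oc (bigcomp2 s').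
Proof.
by move=> E; apply: Cell_oc; apply: Cell_bigcomp2 => k; exact: oc_Cell (E k).
Qed.

Section Identities.
Variables (m n : nat) (phi : family C m n).
Variables (X : fin m.+3 -> fin n.+2 -> obj C) (f : @grid K C m.+1 n.+1 X).

(** Naturality of phi along the invertible [swap_cell] relates the values of psi on the two grids,
    which differ in the merged row. *)
Lemma dh_inner_dv_inner i j : natural phi ->
  dh_inner (fun X f => dv_inner phi j f) i f =
  dv_inner (fun X f => dh_inner phi i f) j f.
Proof.
move=> nphi; apply: (eq_psi (phi := fun X f => dh_inner _ _ f)
  (phi' := fun X f => dv_inner _ _ f)).
rewrite psi_dh_inner.
have A := psi_dv_inner phi j (grid_hmerge i f).
have sc : is_iso (col_comp2 (swap_cell j i f)).
  apply: is_iso_bigtens2 => k; apply: is_iso_bigcomp2 => l.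
  exact: is_iso_swap_cell.
have {}A := conj_vc (psi_natural nphi sc) A.
have B := psi_dv_inner (fun X f => dh_inner phi i f) j f.
rewrite psi_dh_inner in B.
apply: (conj_eq A B) => //.
(* Each conjugating cell precomposed with [Theta (grid_vmerge j f)] gives [Theta f]. For the one
   through [swap_cell], naturality of [Theta] moves the swap to the domain, where [swap_cell_hmerge]
   absorbs it. *)
apply: (vc_cancel (t := Theta f) (is_iso_Theta (grid_vmerge j f))); last first.
  by rewrite -Theta_vmerge.
rewrite (Theta_hmerge i (grid_vmerge j f)) vcA -[vc (vc _ (oc (col_comp2 _)))
  _]vcA.
rewrite [vc (oc (col_comp2 _)) _]vcE -Theta_natural -vcE vcA -Theta_vmerge -vcA.
rewrite vcE -bigcomp2V (Theta_hmerge i f); congr (vc _ _).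
by apply: oc_bigcomp2 => l; rewrite -(swap_cell_hmerge i j f l) vcE.
Qed.

Lemma dh_inner_dv_first i :
  dh_inner (dv_first phi) i f = dv_first (fun X f => dh_inner phi i f) f.
Proof.
apply: (eq_psi (phi := fun X f => dh_inner _ _ f)).
rewrite psi_dh_inner !psi_dv_first psi_dh_inner; congr (tc _ _).
by apply: oc_id2; exact: (Arr_hmerge i (col f None)).
Qed.

Lemma dh_inner_dv_last i :
  dh_inner (dv_last phi) i f = dv_last (fun X f => dh_inner phi i f) f.
Proof.
apply: (eq_psi (phi := fun X f => dh_inner _ _ f)).
rewrite psi_dh_inner !psi_dv_last psi_dh_inner; congr (tc _ _).
by apply: oc_id2; exact: (Arr_hmerge i (col f (fmax n.+1))).
Qed.

(** The conjugating cells agree because, once [Theta] of the merged remaining rows is composed in,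
    both factor [Theta f]: by first row then merge, or by merge then first row. *)
Lemma dh_first_dv_inner j :
  dh_first (fun X f => dv_inner phi j f) f = dv_inner (dh_first phi) j f.
Proof.
apply: (eq_psi (phi' := fun X f => dv_inner _ _ f)).
have e0 : oc (id2 (row_tens f None)) = oc (id2 (row_tens (grid_vmerge j f)
  None)).
  by apply: oc_id2; exact: (esym (Arr_vmerge j (f None))).
have A1 := conj_hc (conj_id1 (id2 (row_tens f None))) (psi_dv_inner phi j
  (del_first_row f)).
have {A1} A := conj_vc (A1 _) (psi_dh_first (fun X f => dv_inner phi j f) f).
have B := conj_vc (psi_dh_first phi (grid_vmerge j f)) (psi_dv_inner (dh_first
  phi) j f).
apply: (conj_eq (A _) B).
- by rewrite e0 hcE.
- apply: (vc_cancel (s := id2 (row_tens (grid_vmerge j f) None) ∘₂ Theta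
  (grid_vmerge j (del_first_row f))) (t := Theta f)).
  + by apply: is_iso_hcomp; [exact: is_iso_id | exact: is_iso_Theta].
  + rewrite -hcE -e0 -vcA -hc_idl -?Theta_vmerge //.
    exact: esym (oc_Theta_first_row f).
  + rewrite -hcE -vcA; rewrite -[vc (oc (Theta_pair _ _)) _](oc_Theta_first_row
    (grid_vmerge j f)).
    by rewrite -Theta_vmerge.
- by rewrite e0.
Qed.

Lemma dh_last_dv_inner j :
  dh_last (fun X f => dv_inner phi j f) f = dv_inner (dh_last phi) j f.
Proof.
apply: (eq_psi (phi' := fun X f => dv_inner _ _ f)).
have e0 : oc (id2 (row_tens f (fmax m.+1))) = oc (id2 (row_tens (grid_vmerge j
  f) (fmax m.+1))).
  by apply: oc_id2; exact: (esym (Arr_vmerge j (f (fmax m.+1)))).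
have A1 := conj_hc (psi_dv_inner phi j (del_last_row f)) (conj_id1 (id2
  (row_tens f (fmax m.+1)))).
have {A1} A := conj_vc (A1 _) (psi_dh_last (fun X f => dv_inner phi j f) f).
have B := conj_vc (psi_dh_last phi (grid_vmerge j f)) (psi_dv_inner (dh_last
  phi) j f).
apply: (conj_eq (A _) B).
- by rewrite e0 hcE.
- apply: (vc_cancel (s := Theta (grid_vmerge j (del_last_row f)) ∘₂ id2
  (row_tens (grid_vmerge j f) (fmax m.+1))) (t := Theta f)).
  + by apply: is_iso_hcomp; [exact: is_iso_Theta | exact: is_iso_id].
  + rewrite -hcE -e0 -vcA -hc_idr -?Theta_vmerge //.
    exact: esym (Theta_last_row f).
  + rewrite -hcE -vcA; rewrite -[vc (oc (Theta_pair _ _)) _](Theta_last_row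
    (grid_vmerge j f)).
    by rewrite -Theta_vmerge.
- by rewrite e0.
Qed.

(** Naturality of [that] on endomorphisms. It serves the four corner cases, an outer row against an
    outer column, where 1 ∘ (1 ⊗ psi) must be compared with 1 ⊗ (1 ∘ psi) or a mirror image. *)
Lemma conj_that (A A' A'' B B' B'' : obj C) (a' : hom A' A'') (b' : hom B' B'')
    (a : hom A A') (b : hom B B') (s' : hom2 a' a') (t' : hom2 b' b')
    (s : hom2 a a) (t : hom2 b b) :
  conjugates (oc (that a' b' a b)) (hc (tc (oc s') (oc t')) (tc (oc s) (oc t)))
    (tc (hc (oc s') (oc s)) (hc (oc t') (oc t))).
Proof.
rewrite !tcE !hcE tcE; apply: conjI; first exact: that_iso.
by rewrite that_natural.
Qed.

Lemma oc_Theta_pairS p (A B D : fin p.+2 -> obj C)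
    (g : forall k, hom (B k) (D k)) (h : forall k, hom (A k) (B k)) :
  oc (Theta_pair g h) =
  vc (tc (oc (id2 (g None ∘ h None)))
     (oc (Theta_pair (fun k => g (Some k)) (fun k => h (Some k)))))
  (oc (that (g None) (bigtens (fun k => g (Some k)))
         (h None) (bigtens (fun k => h (Some k))))).
Proof. by rewrite Theta_pairS tcE; exact: esym (vcE _ _). Qed.

Lemma Theta_pair_last p (A B D : fin p.+2 -> obj C)
    (g : forall k, hom (B k) (D k)) (h : forall k, hom (A k) (B k)) :
  oc (Theta_pair g h) =
  vc (tc (oc (Theta_pair (fun k => g (fwiden k)) (fun k => h (fwiden k))))
         (oc (id2 (g (fmax p.+1) ∘ h (fmax p.+1)))))
  (oc (that (bigtens (fun k => g (fwiden k))) (g (fmax p.+1))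
            (bigtens (fun k => h (fwiden k))) (h (fmax p.+1)))).
Proof.
rewrite [LHS](Theta_last_col (grid2 g h)); congr (vc (tc _ _) _).
by rewrite /= hcomp11 vcomps1.
Qed.

(** [Theta_pair] is [that] followed by 1 ⊗ [Theta_pair] of the later columns. The first factor
    exchanges the two compositions, the second is the conjugation inside [dv_first]. *)
Lemma dh_first_dv_first : dh_first (dv_first phi) f = dv_first (dh_first phi) f.
Proof.
apply: eq_psi; rewrite psi_dv_first.
have A := psi_dh_first (dv_first phi) f.
rewrite psi_dv_first oc_Theta_pairS in A.
have B := conj_tc (conj_id1 (id2 (col_comp f None))) (psi_dh_first phi
  (del_first_col f)).
have B1 := conj_that (id2 (f None None)) (id2 (row_tens (del_first_col f) None))
  (id2 (col_comp (del_first_row f) None)) (psi phi (del_first_row (del_first_col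
    f))).
rewrite [hc (oc (id2 _)) (oc (id2 _))]hcE hcomp11 in B1.
have {}B := conj_vc B1 B.
apply: (conj_eq A B) => //.
by rewrite [tc (oc (id2 _)) (oc (id2 _))]tcE tens2_11.
Qed.

Lemma dh_last_dv_first : dh_last (dv_first phi) f = dv_first (dh_last phi) f.
Proof.
apply: eq_psi; rewrite psi_dv_first.
have A := psi_dh_last (dv_first phi) f.
rewrite psi_dv_first oc_Theta_pairS in A.
have B := conj_tc (conj_id1 (id2 (col_comp (del_last_row f) None ∘ f (fmax m.+1)
  None))) (psi_dh_last phi (del_first_col f)).
have B1 := conj_that (id2 (col_comp (del_last_row f) None)) (psi phi
  (del_last_row (del_first_col f)))
  (id2 (f (fmax m.+1) None)) (id2 (row_tens (del_first_col f) (fmax m.+1))).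
rewrite [hc (oc (id2 _)) (oc (id2 _))]hcE hcomp11 in B1.
have {}B := conj_vc B1 B.
(* [col_comp] is bracketed from the first row, whereas splitting off the last row brackets it the
   other way. *)
have <- : oc (id2 (col_comp (del_last_row f) None ∘ f (fmax m.+1) None)) =
  oc (id2 (col_comp f None)).
  by apply: oc_id2; exact: (Arr_bigcomp_last (col f None)).
apply: (conj_eq A B) => //.
by rewrite [tc (oc (id2 (f _ _))) (oc (id2 _))]tcE tens2_11.
Qed.

Lemma dh_first_dv_last : dh_first (dv_last phi) f = dv_last (dh_first phi) f.
Proof.
apply: eq_psi; rewrite psi_dv_last.
have A := psi_dh_first (dv_last phi) f.
rewrite psi_dv_last Theta_pair_last in A.
have B := conj_tc (psi_dh_first phi (del_last_col f)) (conj_id1 (id2 (col_comp f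
  (fmax n.+1)))).
have B1 := conj_that (id2 (row_tens (del_last_col f) None)) (id2 (f None (fmax
  n.+1)))
  (psi phi (del_first_row (del_last_col f))) (id2 (col_comp (del_first_row f)
    (fmax n.+1))).
rewrite [hc (oc (id2 (f _ _))) (oc (id2 _))]hcE hcomp11 in B1.
have {}B := conj_vc B1 B.
apply: (conj_eq A B) => //.
rewrite [tc (oc (id2 (row_tens _ _))) (oc (id2 _))]tcE tens2_11; congr (hc _ _).
by apply: oc_id2; exact: (esym (Arr_bigtens_last (f None))).
Qed.

Lemma dh_last_dv_last : dh_last (dv_last phi) f = dv_last (dh_last phi) f.
Proof.
apply: eq_psi; rewrite psi_dv_last.
have A := psi_dh_last (dv_last phi) f.
rewrite psi_dv_last Theta_pair_last in A.
have B := conj_tc (psi_dh_last phi (del_last_col f)) (conj_id1 (id2 (col_comp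
  (del_last_row f) (fmax n.+1) ∘ f (fmax m.+1) (fmax n.+1)))).
have B1 := conj_that (psi phi (del_last_row (del_last_col f))) (id2 (col_comp
  (del_last_row f) (fmax n.+1)))
  (id2 (row_tens (del_last_col f) (fmax m.+1))) (id2 (f (fmax m.+1) (fmax
    n.+1))).
rewrite [hc (oc (id2 (col_comp _ _))) (oc (id2 _))]hcE hcomp11 in B1.
have {}B := conj_vc B1 B.
have <- : oc (id2 (col_comp (del_last_row f) (fmax n.+1) ∘ f (fmax m.+1) (fmax
  n.+1))) = oc (id2 (col_comp f (fmax n.+1))).
  by apply: oc_id2; exact: (Arr_bigcomp_last (col f (fmax n.+1))).
apply: (conj_eq A B) => //.
rewrite [tc (oc (id2 (row_tens _ _))) (oc (id2 _))]tcE tens2_11; congr (hc _ _).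
by apply: oc_id2; exact: (esym (Arr_bigtens_last (f (fmax m.+1)))).
Qed.
End Identities.
End MixedIdentities.

(** * Alternating sums *)

Section AlternatingSums.
Variable K : comPzRingType.

(** G b a stands for the composite of cofaces d^b d^a, and b has one more value since its coface
    starts one degree higher. Passing from N to N + 1 adds the terms with b = N + 1 and those with a
    = N; the relation with j = N pairs them with opposite signs. *)
Lemma altsum_cosimplicial (V : lmodType K) (G : nat -> nat -> V) N :
  (forall i j, (i <= j < N)%N -> G j.+1 i = G i j) ->
  \sum_(b < N.+1) \sum_(a < N) (-1 : K) ^+ (b + a) *: G b a = 0.
Proof.
elim: N => [|N IHN] E; first by apply: big1 => b _; rewrite big_ord0.
rewrite big_ord_recr /=.
under eq_bigr => b _ do rewrite big_ord_recr /=.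
rewrite big_split /= IHN ?add0r => [|i j /andP[ij jN]]; last first.
  by apply: E; rewrite ij ltnW.
rewrite -big_split big1 // => a _ /=.
have aN : (a <= N)%N by rewrite -ltnS ltn_ord.
rewrite E ?aN ?ltnSn //.
by rewrite addSn exprS addnC mulN1r scaleNr addrN.
Qed.

Lemma linear_altsum (U V : lmodType K) (h : U -> V) (lh : linear h) N
    (e : 'I_N -> K) (u : 'I_N -> U) :
  h (\sum_i e i *: u i) = \sum_i e i *: h (u i).
Proof.
elim/big_ind2: _ => [|x x' y y' <- <-|i _]; first exact: linear_fun0 lh.
  exact: linear_funD lh _ _.
exact: linear_funZ lh _ _.
Qed.

(* The element min(i, n) of [fin n.+1]. *)
Fixpoint ofn n (i : nat) : fin n.+1 :=
  match n, i with
  | p.+1, j.+1 => Some (ofn p j)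
  | _, _ => None
  end.

Lemma ofn_widen n i : (i <= n)%N -> ofn n.+1 i = fwiden (ofn n i).
Proof. by elim: n i => [|n IHn] [|i] // li; congr Some; exact: IHn. Qed.

Lemma ofn_max n : ofn n n = fmax n.
Proof. by elim: n => //= n ->. Qed.

Lemma fval_ofn n i : (i <= n)%N -> fval (ofn n i) = i.
Proof. by elim: n i => [|n IHn] [|i] // li; congr _.+1; exact: IHn. Qed.

(** Passes from the iterated option types of the differentials to ordinals, where the first and last
    summands can be split off. *)
Lemma sum_fin (V : lmodType K) n (F : fin n.+1 -> V) :
  \sum_(i : fin n.+1) F i = \sum_(i < n.+1) F (ofn n i).
Proof.
elim: n F => [|n IHn] F.
  rewrite big_ord1 (bigD1 (None : fin 1)) //= big1 ?addr0 //.
  by move=> [[]|].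
rewrite big_ord_recl (bigD1 (None : fin n.+2)) //=; congr (_ + _).
rewrite -(IHn (fun i => F (Some i))).
rewrite (reindex_onto (Some : fin n.+1 -> fin n.+2) (odflt None)) //=.
  by apply: eq_bigl => i; rewrite eqxx.
by case.
Qed.
End AlternatingSums.

(** * The differentials as alternating sums of cofaces *)

Section Faces.
Variables (K : comPzRingType) (C : linear_gray_semigroup K).

Lemma cochain_sumE m n N (phi : 'I_N -> cochain C m n) X (f : grid X) :
  (\sum_i phi i) X f = \sum_i phi i X f.
Proof.
by elim/big_ind2: _ => // x x' y y' <- <-.
Qed.

(* The [a]-th coface of the alternating sum; meaningful only for [a <= m.+2]. *)
Definition hface m n a (phi : cochain C m n) : cochain C m.+1 n :=
  if a is b.+1 then
    if b == m.+1 then Cochain (dh_last_natural (@cofun_natural _ _ _ _ phi))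
    else Cochain (dh_inner_natural (ofn m b) (@cofun_natural _ _ _ _ phi))
  else Cochain (dh_first_natural (@cofun_natural _ _ _ _ phi)).

Definition vface m n a (phi : cochain C m n) : cochain C m n.+1 :=
  if a is b.+1 then
    if b == n.+1 then Cochain (dv_last_natural (@cofun_natural _ _ _ _ phi))
    else Cochain (dv_inner_natural (ofn n b) (@cofun_natural _ _ _ _ phi))
  else Cochain (dv_first_natural (@cofun_natural _ _ _ _ phi)).

Lemma hface_last m n (phi : cochain C m n) :
  hface m.+2 phi = Cochain (dh_last_natural (@cofun_natural _ _ _ _ phi)).
Proof. by rewrite /= eqxx. Qed.

Lemma hface_inner m n a (phi : cochain C m n) : (a <= m)%N ->
  hface a.+1 phi =
  Cochain (dh_inner_natural (ofn m a) (@cofun_natural _ _ _ _ phi)).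
Proof. by move=> am; rewrite /= ltn_eqF. Qed.

Lemma vface_last m n (phi : cochain C m n) :
  vface n.+2 phi = Cochain (dv_last_natural (@cofun_natural _ _ _ _ phi)).
Proof. by rewrite /= eqxx. Qed.

Lemma vface_inner m n a (phi : cochain C m n) : (a <= n)%N ->
  vface a.+1 phi =
  Cochain (dv_inner_natural (ofn n a) (@cofun_natural _ _ _ _ phi)).
Proof. by move=> an; rewrite /= ltn_eqF. Qed.

Lemma hface_linear m n a : linear (@hface m n a).
Proof.
move=> c p q; apply: cochain_eq => X f; case: a => [|a] /=.
  by rewrite /dh_first hcomp_linearr vcomp_linearr.
case: eqP => _ /=.
  by rewrite /dh_last hcomp_linearl vcomp_linearr cast_linear.
by rewrite /dh_inner vcomp_linearl cast_linear.
Qed.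

Lemma vface_linear m n a : linear (@vface m n a).
Proof.
move=> c p q; apply: cochain_eq => X f; case: a => [|a] /=.
  by rewrite /dv_first tens2_linearr vcomp_linearl.
case: eqP => _ /=.
  by rewrite /dv_last tens2_linearl vcomp_linearl cast_linear.
by rewrite /dv_inner vcomp_linearr cast_linear.
Qed.

Lemma delta_hE m n (phi : cochain C m n) :
  delta_h phi = \sum_(a < m.+3) (-1) ^+ a *: hface a phi.
Proof.
apply: cochain_eq => X f; rewrite cochain_sumE.
have -> : delta_h phi X f = dh_first phi f
    + (\sum_(i < m.+1) (-1) ^+ i.+1 *: dh_inner phi (ofn m i) f
       + (-1) ^+ m.+2 *: dh_last phi f).
  rewrite [LHS]/(dh phi f) /dh sum_fin -addrA; congr (_ + (_ + _)).
  by apply: eq_bigr => i _; rewrite fval_ofn // -ltnS ltn_ord.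
rewrite [RHS]big_ord_recl [in RHS]big_ord_recr expr0 scale1r /bump /= eqxx.
congr (_ + (_ + _)); apply: eq_bigr => i _.
by rewrite ltn_eqF ?add0n ?ltn_ord.
Qed.

Lemma delta_vE m n (phi : cochain C m n) :
  delta_v phi = \sum_(a < n.+3) (-1) ^+ a *: vface a phi.
Proof.
apply: cochain_eq => X f; rewrite cochain_sumE.
have -> : delta_v phi X f = dv_first phi f
    + (\sum_(i < n.+1) (-1) ^+ i.+1 *: dv_inner phi (ofn n i) f
       + (-1) ^+ n.+2 *: dv_last phi f).
  rewrite [LHS]/(dv phi f) /dv sum_fin -addrA; congr (_ + (_ + _)).
  by apply: eq_bigr => i _; rewrite fval_ofn // -ltnS ltn_ord.
rewrite [RHS]big_ord_recl [in RHS]big_ord_recr expr0 scale1r /bump /= eqxx.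
congr (_ + (_ + _)); apply: eq_bigr => i _.
by rewrite ltn_eqF ?add0n ?ltn_ord.
Qed.

Lemma hface_hface m n (phi : cochain C m n) i j : (i <= j < m.+3)%N ->
  hface j.+1 (hface i phi) = hface i (hface j phi).
Proof.
case/andP=> lij; rewrite ltnS leq_eqVlt => /orP[/eqP ej|lj].
  subst j; rewrite !hface_last.
  case: i lij => [|i]; first by move=> _; apply: cochain_eq => X f;
    exact: dh_last_first.
  (* The index m + 2 is the last coface in degree m but still an inner one, that of [fmax], in
     degree m + 1. *)
  rewrite ltnS leq_eqVlt => /orP[/eqP ->|li].
    rewrite hface_last hface_inner // ofn_max.
    by apply: cochain_eq => X f; exact: dh_last_last.
  rewrite ltnS in li; have li' := leqW li; rewrite !hface_inner // (@ofn_widen _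
    i li).
  by apply: cochain_eq => X f; exact: dh_last_inner.
rewrite hface_inner //; case: i lij => [_|i lij].
  case: j lj => [|j] lj; apply: cochain_eq => X f; first exact: dh_inner_first0.
  by rewrite [hface j.+1 _]hface_inner //; exact: dh_inner_first.
case: j lj lij => // j; rewrite !ltnS => lj lij; have li := leq_trans lij lj.
have li' := leqW li.
rewrite !hface_inner // (ofn_widen li); apply: cochain_eq => X f.
by apply: dh_inner_inner; rewrite !fval_ofn.
Qed.

Lemma vface_vface m n (phi : cochain C m n) i j : (i <= j < n.+3)%N ->
  vface j.+1 (vface i phi) = vface i (vface j phi).
Proof.
case/andP=> lij; rewrite ltnS leq_eqVlt => /orP[/eqP ej|lj].
  subst j; rewrite !vface_last.
  case: i lij => [|i]; first by move=> _; apply: cochain_eq => X f;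
    exact: dv_last_first.
  rewrite ltnS leq_eqVlt => /orP[/eqP ->|li].
    rewrite vface_last vface_inner // ofn_max.
    by apply: cochain_eq => X f; exact: dv_last_last.
  rewrite ltnS in li; have li' := leqW li; rewrite !vface_inner // (@ofn_widen _
    i li).
  by apply: cochain_eq => X f; exact: dv_last_inner.
rewrite vface_inner //; case: i lij => [_|i lij].
  case: j lj => [|j] lj; apply: cochain_eq => X f; first exact: dv_inner_first0.
  by rewrite [vface j.+1 _]vface_inner //; exact: dv_inner_first.
case: j lj lij => // j; rewrite !ltnS => lj lij; have li := leq_trans lij lj.
have li' := leqW li.
rewrite !vface_inner // (ofn_widen li); apply: cochain_eq => X f.
by apply: dv_inner_inner; rewrite !fval_ofn.
Qed.

(** Destructing one such index for each direction yields the nine mixed identities. *)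
Variant face_index m : nat -> Type :=
  | FirstFace : face_index m 0
  | InnerFace a of (a <= m)%N : face_index m a.+1
  | LastFace : face_index m m.+2.

Lemma face_indexP m a : (a < m.+3)%N -> face_index m a.
Proof.
case: a => [|a]; first by move=> _; exact: FirstFace.
rewrite !ltnS leq_eqVlt; case: eqP => [-> _|_ /=]; first exact: LastFace.
by rewrite ltnS; exact: InnerFace.
Qed.

Lemma hface_vface m n (phi : cochain C m n) a b : (a < m.+3)%N -> (b < n.+3)%N
  ->
  hface a (vface b phi) = vface b (hface a phi).
Proof.
move=> /face_indexP[|{}a la|] /face_indexP[|{}b lb|];
  rewrite ?hface_last ?vface_last ?hface_inner ?vface_inner //;
  apply: cochain_eq => X f.
- exact: dh_first_dv_first.
- exact: dh_first_dv_inner.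
- exact: dh_first_dv_last.
- exact: dh_inner_dv_first.
- exact: dh_inner_dv_inner (@cofun_natural _ _ _ _ phi).
- exact: dh_inner_dv_last.
- exact: dh_last_dv_first.
- exact: dh_last_dv_inner.
- exact: dh_last_dv_last.
Qed.

End Faces.

Theorem theorem8p3 (K : comPzRingType) (C : linear_gray_semigroup K) :
  @double_complex K (fun m n => cochain C m n)
    (fun m n => @delta_h K C m n) (fun m n => @delta_v K C m n).
Proof.
split=> m n phi /=.
- rewrite delta_hE delta_hE.
  under eq_bigr => b _ do
    rewrite (linear_altsum (@hface_linear _ _ _ _ b)) scaler_sumr.
  under eq_bigr => b _ do under eq_bigr => a _ do rewrite scalerA -exprD.
  by apply: (altsum_cosimplicial (G := fun b a => hface b (hface a phi))) => i
    j; exact: hface_hface.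
- rewrite delta_vE delta_vE.
  under eq_bigr => b _ do
    rewrite (linear_altsum (@vface_linear _ _ _ _ b)) scaler_sumr.
  under eq_bigr => b _ do under eq_bigr => a _ do rewrite scalerA -exprD.
  by apply: (altsum_cosimplicial (G := fun b a => vface b (vface a phi))) => i
    j; exact: vface_vface.
rewrite delta_hE delta_vE delta_vE delta_hE.
under eq_bigr => b _ do
  rewrite (linear_altsum (@hface_linear _ _ _ _ b)) scaler_sumr.
under [RHS]eq_bigr => b _ do
  rewrite (linear_altsum (@vface_linear _ _ _ _ b)) scaler_sumr.
(* No cancellation occurs here: the two double sums agree term by term once the order of summation
   is exchanged. *)
rewrite exchange_big; apply: eq_bigr => b _; apply: eq_bigr => a _.
by rewrite !scalerA mulrC hface_vface.
Qed.
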